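(* Let $R$ and $S$ be associative rings and let ${}_SC_R$ be a faithfully semidualizing $(S,R)$-bimodule. (a) The class $\mathcal{F}_C(S)$ is closed under pure submodules and pure quotients. (b) When $S$ is left noetherian, the class $\mathcal{I}_C(R)$ is closed under pure submodules and pure quotients.
   Context: Rings are associative with unity (not necessarily commutative or noetherian). Modules are unital left modules; right $R$-modules are identified with left $R^{\mathrm{op}}$-modules. An $(S,R)$-bimodule $C={}_SC_R$ is semidualizing if: (a1) ${}_SC$ admits a degreewise finite $S$-projective resolution (a projective resolution by finitely generated projectives); (a2) $C_R$ admits a degreewise finite $R^{\mathrm{op}}$-projective resolution; (b1) the homothety map $S\to\operatorname{Hom}_{R^{\mathrm{op}}}(C,C)$, $s\mapsto(x\mapsto sx)$, is an isomorphism; (b2) the homothety map $R\to\operatorname{Hom}_S(C,C)$, $r\mapsto(x\mapsto xr)$, is an isomorphism; (c1) $\operatorname{Ext}_S^{i}(C,C)=0$ for all $i\geq1$; (c2) $\operatorname{Ext}_{R^{\mathrm{op}}}^{i}(C,C)=0$ for all $i\geq 1$. It is faithfully semidualizing if moreover, for all left $S$-modules $N$ and right $R$-modules $M$: $\operatorname{Hom}_S(C,N)=0$ implies $N=0$, and $\operatorname{Hom}_{R^{\mathrm{op}}}(C,M)=0$ implies $M=0$. $\mathcal{F}_C(S)=\{C\otimes_RF\mid {}_RF\text{ flat}\}$, $\mathcal{I}_C(R)=\{\operatorname{Hom}_S(C,I)\mid {}_SI\text{ injective}\}$ (closed under isomorphism). A short exact sequence $X=\ 0\to N'\to N\to N''\to0$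 of left modules over a ring $A$ is pure exact if $B\otimes_AX$ is exact for all right $A$-modules $B$ (equivalently, $\operatorname{Hom}_A(B,X)$ is exact for all finitely presented left $A$-modules $B$); then $N'$ is a pure submodule of $N$ and $N''$ a pure quotient of $N$. *)

(* Defs.v *)
From HB Require Import structures.
From mathcomp Require Import all_boot all_algebra.
From mathcomp Require Import boolp.

Set Implicit Arguments.
Unset Strict Implicit.
Unset Printing Implicit Defensive.

Import GRing.Theory.
Local Open Scope ring_scope.
Local Open Scope quotient_scope.

(* Left A-modules are [lmodType A] and right A-modules are [lmodType A^c]:
   for m in a right module, [(r : A^c) *: m] is m r.  Rings are [pzRingType],
   so the zero ring is allowed. *)

HB.mixin Record Lmodule_isBimodule (S R : pzRingType) C
    & GRing.Lmodule S C := {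
  actr : C -> R -> C;
  actrDl : forall (r : R) (x y : C), actr (x + y) r = actr x r + actr y r;
  actrDr : forall (x : C) (r r' : R), actr x (r + r') = actr x r + actr x r';
  actr1 : forall x : C, actr x 1 = x;
  actrA : forall (x : C) (r r' : R), actr (actr x r) r' = actr x (r * r');
  actrZ : forall (s : S) (x : C) (r : R), actr (s *: x) r = s *: actr x r
}.

#[short(type="bimodType")]
HB.structure Definition Bimodule (S R : pzRingType) :=
  {C of GRing.Lmodule S C & Lmodule_isBimodule S R C}.

(* C_R: the same abelian group, with the right action as R^c-scaling. *)
Definition rightmod (S R : pzRingType) (C : bimodType S R) : Type := C.

Section RightModule.
Variables (S R : pzRingType) (C : bimodType S R).

HB.instance Definition _ := GRing.Zmodule.copy (rightmod C) C.

Let rscale (r : R^c) (x : rightmod C) : rightmod C := actr (x : C) (r : R).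

Let rscaleA r r' x : rscale r (rscale r' x) = rscale (r * r') x.
Proof. exact: actrA. Qed.

Let rscale1 : left_id 1 rscale.
Proof. exact: actr1. Qed.

Let rscaleDr : right_distributive rscale +%R.
Proof. by move=> r x y; apply: actrDl. Qed.

Let rscaleDl x : {morph rscale^~ x : r r' / r + r'}.
Proof. by move=> r r'; apply: actrDr. Qed.

HB.instance Definition _ := GRing.Zmodule_isLmodule.Build R^c (rightmod C)
  rscaleA rscale1 rscaleDr rscaleDl.

Definition lmul (s : S) (x : rightmod C) : rightmod C := s *: (x : C).

Let lmul_linear s : linear (lmul s).
Proof.
move=> r x y; rewrite /lmul; change (s *: (actr (x : C) r + (y : C))
  = actr (s *: (x : C)) r + s *: (y : C)).
by rewrite scalerDr actrZ.
Qed.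

HB.instance Definition _ s := GRing.isLinear.Build R^c (rightmod C) (rightmod C)
  _ (lmul s) (lmul_linear s).

Definition rmul (r : R) (x : C) : C := actr x r.

Let rmul_linear r : linear (rmul r).
Proof. by move=> s x y; rewrite /rmul actrDl actrZ. Qed.

HB.instance Definition _ r := GRing.isLinear.Build S C C _ (rmul r)
  (rmul_linear r).

End RightModule.

Definition lmodHom (A : pzRingType) (M N : lmodType A) : Type := {linear M -> N}.

Section HomGroup.
Variables (A : pzRingType) (M N : lmodType A).
Implicit Types f g h : lmodHom M N.

Lemma hom_ext f g : f =1 g -> f = g.
Proof.
case: f g => [f [[f1] [f2]]] [g [[g1] [g2]]] /= /funext fg.
by case: _ / fg in g1 g2 *; rewrite (Prop_irrelevance f1 g1) (Prop_irrelevance f2 g2).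
Qed.

HB.instance Definition _ := gen_eqMixin (lmodHom M N).
HB.instance Definition _ := gen_choiceMixin (lmodHom M N).

Let hom0 : lmodHom M N := \0.
Let homN f : lmodHom M N := \- f.
Let homD f g : lmodHom M N := f \+ g.

Let homDA : associative homD.
Proof. by move=> f g h; apply: hom_ext => x; apply: addrA. Qed.

Let homDC : commutative homD.
Proof. by move=> f g; apply: hom_ext => x; apply: addrC. Qed.

Let hom0D : left_id hom0 homD.
Proof. by move=> f; apply: hom_ext => x; apply: add0r. Qed.

Let homND : left_inverse hom0 homN homD.
Proof. by move=> f; apply: hom_ext => x; apply: addNr. Qed.

HB.instance Definition _ := GRing.isZmodule.Build (lmodHom M N)
  homDA homDC hom0D homND.

End HomGroup.

Definition precomp (A : pzRingType) (M M' N : lmodType A)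
  (f : {linear M -> M'}) (h : lmodHom M' N) : lmodHom M N := h \o f.

(* Hom_S(C, N) as a left R-module, (r f)(x) = f (x r). *)
Definition bihom (S R : pzRingType) (C : bimodType S R) (N : lmodType S) : Type :=
  lmodHom C N.

Section BiHom.
Variables (S R : pzRingType) (C : bimodType S R) (N : lmodType S).

HB.instance Definition _ := GRing.Zmodule.copy (bihom C N) (lmodHom C N).

Let bscale (r : R) (f : bihom C N) : bihom C N := precomp (rmul r) f.

Let bscaleA r r' f : bscale r (bscale r' f) = bscale (r * r') f.
Proof. by apply: hom_ext => x /=; rewrite /rmul actrA. Qed.

Let bscale1 : left_id 1 bscale.
Proof. by move=> f; apply: hom_ext => x /=; rewrite /rmul actr1. Qed.

Let bscaleDr : right_distributive bscale +%R.
Proof. by move=> r f g; apply: hom_ext. Qed.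

Let bscaleDl f : {morph bscale^~ f : r r' / r + r'}.
Proof.
move=> r r'; apply: hom_ext => x /=.
by rewrite /rmul actrDr; apply: raddfD.
Qed.

HB.instance Definition _ := GRing.Zmodule_isLmodule.Build R (bihom C N)
  bscaleA bscale1 bscaleDr bscaleDl.

End BiHom.

(* M (x)_A F is built from finite formal sums of pure tensors, represented as
   sequences, modulo the least congruence containing the bilinearity and
   balancing relations.  Negatives come for free, as - (m (x) x) = (- m) (x) x. *)
Section Tensor.
Variables (A : pzRingType) (M : lmodType A^c) (F : lmodType A).

Inductive tensor_rel : seq (M * F) -> seq (M * F) -> Prop :=
| tensor_rel_refl s : tensor_rel s s
| tensor_rel_sym s t : tensor_rel s t -> tensor_rel t s
| tensor_rel_trans s t u : tensor_rel s t -> tensor_rel t u -> tensor_rel s u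
| tensor_rel_cat s s' t t' :
    tensor_rel s s' -> tensor_rel t t' -> tensor_rel (s ++ t) (s' ++ t')
| tensor_rel_comm s t : tensor_rel (s ++ t) (t ++ s)
| tensor_rel_zero x : tensor_rel [:: (0, x)] [::]
| tensor_rel_addl m m' x : tensor_rel [:: (m + m', x)] [:: (m, x); (m', x)]
| tensor_rel_addr m x x' : tensor_rel [:: (m, x + x')] [:: (m, x); (m, x')]
| tensor_rel_bal m (a : A) x :
    tensor_rel [:: ((a : A^c) *: m, x)] [:: (m, a *: x)].

Definition tensor_relb : rel (seq (M * F)) := fun s t => `[< tensor_rel s t >].

Let tensor_relb_refl : reflexive tensor_relb.
Proof. by move=> s; apply/asboolP; constructor. Qed.

Let tensor_relb_sym : symmetric tensor_relb.
Proof. by move=> s t; apply/asboolP/asboolP; apply: tensor_rel_sym. Qed.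

Let tensor_relb_trans : transitive tensor_relb.
Proof.
move=> t s u /asboolP st /asboolP tu; apply/asboolP.
exact: tensor_rel_trans st tu.
Qed.

Canonical tensor_equiv :=
  EquivRel tensor_relb tensor_relb_refl tensor_relb_sym tensor_relb_trans.

Definition tensor : Type := {eq_quot tensor_equiv}.

HB.instance Definition _ := Choice.copy tensor {eq_quot tensor_equiv}.

Definition tensor_of (s : seq (M * F)) : tensor := \pi_({eq_quot tensor_equiv}) s.
Definition tensor_repr (t : tensor) : seq (M * F) :=
  repr (t : {eq_quot tensor_equiv}).

Lemma tensor_reprK t : tensor_of (tensor_repr t) = t.
Proof. exact: reprK. Qed.

Lemma tensor_ofP s t : tensor_of s = tensor_of t <-> tensor_rel s t.
Proof. by split=> [/eqmodP/asboolP|st] //; apply/eqmodP/asboolP. Qed.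

Lemma tensor_repr_of s : tensor_rel (tensor_repr (tensor_of s)) s.
Proof. by apply/tensor_ofP; rewrite tensor_reprK. Qed.

Let tzero := tensor_of [::].
Let tadd t u := tensor_of (tensor_repr t ++ tensor_repr u).
Let topp t := tensor_of [seq (- p.1, p.2) | p <- tensor_repr t].

Let taddE s t : tadd (tensor_of s) (tensor_of t) = tensor_of (s ++ t).
Proof. by apply/tensor_ofP/tensor_rel_cat; apply: tensor_repr_of. Qed.

Let taddA : associative tadd.
Proof.
move=> t u v; rewrite -[t]tensor_reprK -[u]tensor_reprK -[v]tensor_reprK.
by rewrite !taddE catA.
Qed.

Let taddC : commutative tadd.
Proof. by move=> t u; apply/tensor_ofP/tensor_rel_comm. Qed.

Let tadd0 : left_id tzero tadd.
Proof. by move=> t; rewrite -[t]tensor_reprK taddE. Qed.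

Let taddN : left_inverse tzero topp tadd.
Proof.
move=> t; rewrite -[in X in tadd _ X](tensor_reprK t) taddE.
apply/tensor_ofP; elim: (tensor_repr t) => [|[m x] s IHs] /=.
  exact: tensor_rel_refl.
rewrite -cat1s; apply: (@tensor_rel_trans _ ([:: (- m, x); (m, x)]
    ++ ([seq (- p.1, p.2) | p <- s] ++ s))).
  rewrite -[(m, x) :: s]cat1s -[[:: _; _]]cat1s -!catA.
  apply: tensor_rel_cat; first exact: tensor_rel_refl.
  rewrite !catA; apply: tensor_rel_cat; last exact: tensor_rel_refl.
  exact: tensor_rel_comm.
rewrite -[[::]]cats0; apply: tensor_rel_cat => //.
apply: tensor_rel_trans (tensor_rel_sym (tensor_rel_addl _ _ _)) _.
by rewrite addNr; apply: tensor_rel_zero.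
Qed.

HB.instance Definition _ := GRing.isZmodule.Build tensor taddA taddC tadd0 taddN.

Lemma tensor_of_cat s t : tensor_of (s ++ t) = tensor_of s + tensor_of t.
Proof. by rewrite -[RHS]/(tadd _ _) taddE. Qed.

Definition pure_tensor (m : M) (x : F) : tensor := tensor_of [:: (m, x)].

End Tensor.

Section TensorMap.
Variables (A : pzRingType) (M M' : lmodType A^c) (F F' : lmodType A).
Variables (f : {linear M -> M'}) (g : {linear F -> F'}).

Definition tensor_map (t : tensor M F) : tensor M' F' :=
  tensor_of [seq (f p.1, g p.2) | p <- tensor_repr t].

Lemma tensor_map_of s :
  tensor_map (tensor_of s) = tensor_of [seq (f p.1, g p.2) | p <- s].
Proof.
apply/tensor_ofP; move: (tensor_repr _) (tensor_repr_of s) => s'.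
elim: s' s / => /=.
- by move=> ?; apply: tensor_rel_refl.
- by move=> *; apply: tensor_rel_sym.
- by move=> ? t ? _ st _ tu; apply: tensor_rel_trans st tu.
- by move=> *; rewrite !map_cat; apply: tensor_rel_cat.
- by move=> *; rewrite !map_cat; apply: tensor_rel_comm.
- by move=> x; rewrite linear0; apply: tensor_rel_zero.
- by move=> m m' x; rewrite linearD; apply: tensor_rel_addl.
- by move=> m x x'; rewrite linearD; apply: tensor_rel_addr.
- by move=> m a x; rewrite !linearZ; apply: tensor_rel_bal.
Qed.

Lemma tensor_map_is_additive : zmod_morphism tensor_map.
Proof.
have tD : {morph tensor_map : t u / t + u}.
  move=> t u; rewrite -[t]tensor_reprK -[u]tensor_reprK.
  by rewrite -tensor_of_cat !tensor_map_of map_cat tensor_of_cat.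
by move=> t u; apply: (addIr (tensor_map u)); rewrite -tD !subrK.
Qed.

HB.instance Definition _ := GRing.isZmodMorphism.Build (tensor M F)
  (tensor M' F') tensor_map tensor_map_is_additive.

Lemma tensor_map_pure m x :
  tensor_map (pure_tensor m x) = pure_tensor (f m) (g x).
Proof. exact: tensor_map_of. Qed.

End TensorMap.

Arguments tensor_map {A M M' F F'} f g t.

(* C (x)_R F as a left S-module, s (c (x) x) = (s c) (x) x. *)
Definition bitensor (S R : pzRingType) (C : bimodType S R) (F : lmodType R) : Type :=
  tensor (rightmod C) F.

Section BiTensor.
Variables (S R : pzRingType) (C : bimodType S R) (F : lmodType R).

HB.instance Definition _ := GRing.Zmodule.copy (bitensor C F)
  (tensor (rightmod C) F).

Let tscale (s : S) (t : bitensor C F) : bitensor C F :=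
  tensor_map (@lmul S R C s) idfun t.

Let tscaleA s s' t : tscale s (tscale s' t) = tscale (s * s') t.
Proof.
rewrite /tscale -[t]tensor_reprK !(tensor_map_of _ _ (tensor_repr t)).
rewrite tensor_map_of -map_comp.
congr (tensor_of _); apply: eq_map => -[c x] /=.
by rewrite /lmul scalerA.
Qed.

Let tscale1 : left_id 1 tscale.
Proof.
move=> t; rewrite /tscale -[t]tensor_reprK tensor_map_of.
rewrite -[in RHS](map_id (tensor_repr t)); congr (tensor_of _).
by apply: eq_map => -[c x] /=; rewrite /lmul scale1r.
Qed.

Let tscaleDr : right_distributive tscale +%R.
Proof. by move=> s t u; apply: raddfD. Qed.

Let tscaleDl t : {morph tscale^~ t : s s' / s + s'}.
Proof.
move=> s s'; rewrite /tscale -[t]tensor_reprK !tensor_map_of.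
rewrite -[RHS]tensor_of_cat; apply/tensor_ofP.
elim: (tensor_repr t) => [|[c x] l IHl] /=; first exact: tensor_rel_refl.
rewrite /lmul scalerDl -cat1s.
apply: tensor_rel_trans (tensor_rel_cat (tensor_rel_addl _ _ _) IHl) _.
rewrite -[[:: _; _]]cat1s -[X in tensor_rel _ X]cat1s -!catA.
apply: tensor_rel_cat; first exact: tensor_rel_refl.
rewrite -[X in tensor_rel _ (_ ++ X)]cat1s !catA.
apply: tensor_rel_cat; last exact: tensor_rel_refl.
exact: tensor_rel_comm.
Qed.

HB.instance Definition _ := GRing.Zmodule_isLmodule.Build S (bitensor C F)
  tscaleA tscale1 tscaleDr tscaleDl.

End BiTensor.

Definition exact_at (L M N : zmodType) (f : L -> M) (g : M -> N) : Prop :=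
  forall y, g y = 0 <-> exists x, f x = y.

Definition surjective (T U : Type) (f : T -> U) : Prop :=
  forall y, exists x, f x = y.

Definition short_exact (L M N : zmodType) (f : L -> M) (g : M -> N) : Prop :=
  [/\ injective f, exact_at f g & surjective g].

Definition lmod_iso (A : pzRingType) (M N : lmodType A) : Prop :=
  exists f : {linear M -> N}, bijective f.

Definition flat (A : pzRingType) (F : lmodType A) : Prop :=
  forall (L M N : lmodType A^c) (f : {linear L -> M}) (g : {linear M -> N}),
    short_exact f g ->
    short_exact (tensor_map f (@idfun F)) (tensor_map g (@idfun F)).

Definition injective_module (A : pzRingType) (I : lmodType A) : Prop :=
  forall (M N : lmodType A) (i : {linear M -> N}) (f : {linear M -> I}),
    injective i -> exists g : {linear N -> I}, g \o i =1 f.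

Definition projective_module (A : pzRingType) (P : lmodType A) : Prop :=
  forall (M N : lmodType A) (p : {linear M -> N}) (f : {linear P -> N}),
    surjective p -> exists g : {linear P -> M}, p \o g =1 f.

Definition pure_exact (A : pzRingType) (L M N : lmodType A)
    (f : {linear L -> M}) (g : {linear M -> N}) : Prop :=
  short_exact f g /\
  forall B : lmodType A^c,
    short_exact (tensor_map (@idfun B) f) (tensor_map (@idfun B) g).

Definition closed_pure_sub (A : pzRingType) (K : lmodType A -> Prop) : Prop :=
  forall (N' N N'' : lmodType A) (f : {linear N' -> N}) (g : {linear N -> N''}),
    pure_exact f g -> K N -> K N'.

Definition closed_pure_quo (A : pzRingType) (K : lmodType A -> Prop) : Prop :=
  forall (N' N N'' : lmodType A) (f : {linear N' -> N}) (g : {linear N -> N''}),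
    pure_exact f g -> K N -> K N''.

Definition finitely_generated (A : pzRingType) (M : lmodType A) : Prop :=
  exists (n : nat) (e : 'I_n -> M),
    forall x, exists a : 'I_n -> A, x = \sum_(i < n) a i *: e i.

Definition left_ideal (A : pzRingType) (J : A -> Prop) : Prop :=
  [/\ J 0, forall x y, J x -> J y -> J (x + y) & forall a x, J x -> J (a * x)].

Definition left_noetherian (A : pzRingType) : Prop :=
  forall J : A -> Prop, left_ideal J ->
    exists (n : nat) (e : 'I_n -> A), (forall i, J (e i)) /\
      forall x, J x -> exists a : 'I_n -> A, x = \sum_(i < n) a i * e i.

Record proj_resolution (A : pzRingType) (M : lmodType A) := ProjResolution {
  res_obj :> nat -> lmodType A;
  res_d : forall n, {linear res_obj n.+1 -> res_obj n};
  res_aug : {linear res_obj 0%N -> M};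
  res_proj : forall n, projective_module (res_obj n);
  res_exact : forall n, exact_at (res_d n.+1) (res_d n);
  res_exact0 : exact_at (res_d 0%N) res_aug;
  res_aug_surj : surjective res_aug
}.

Definition degreewise_finite (A : pzRingType) (M : lmodType A)
    (P : proj_resolution M) : Prop :=
  forall n, finitely_generated (P n).

(* Ext^i(M, N) = 0: the complex Hom(P, N) has no cohomology in degree i.  This
   does not depend on the projective resolution P of M, and every M has one,
   so quantifying over all P is the usual definition. *)
Definition Ext_vanishes (A : pzRingType) (i : nat) (M N : lmodType A) : Prop :=
  forall P : proj_resolution M,
    if i is j.+1 then
      exact_at (precomp (N := N) (res_d P j)) (precomp (N := N) (res_d P j.+1))
    else forall h : lmodHom (P 0%N) N, precomp (res_d P 0%N) h = 0 -> h = 0.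

Section Semidualizing.
Variables (S R : pzRingType) (C : bimodType S R).

Definition lhomothety (s : S) : lmodHom (rightmod C) (rightmod C) := @lmul S R C s.
Definition rhomothety (r : R) : lmodHom C C := @rmul S R C r.

Record semidualizing : Prop := Semidualizing {
  semidualizing_a1 : exists P : proj_resolution C, degreewise_finite P;
  semidualizing_a2 : exists P : proj_resolution (rightmod C), degreewise_finite P;
  semidualizing_b1 : bijective lhomothety;
  semidualizing_b2 : bijective rhomothety;
  semidualizing_c1 : forall i, (1 <= i)%N -> Ext_vanishes i C C;
  semidualizing_c2 : forall i, (1 <= i)%N ->
    Ext_vanishes i (rightmod C) (rightmod C)
}.

Record faithfully_semidualizing : Prop := FaithfullySemidualizing {
  faithfully_semidualizing_semidualizing :> semidualizing;
  faithful_left : forall N : lmodType S,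
    (forall f : lmodHom C N, f = 0) -> forall x : N, x = 0;
  faithful_right : forall M : lmodType R^c,
    (forall f : lmodHom (rightmod C) M, f = 0) -> forall x : M, x = 0
}.

(* F_C(S) and I_C(R), closed under isomorphism. *)
Definition C_flat (N : lmodType S) : Prop :=
  exists F : lmodType R, flat F /\ lmod_iso (bitensor C F) N.

Definition C_injective (M : lmodType R) : Prop :=
  exists I : lmodType S, injective_module I /\ lmod_iso (bihom C I) M.

End Semidualizing.

(* Main.v *)
Require Import Defs.
From HB Require Import structures.
From mathcomp Require Import all_boot all_algebra.
From mathcomp Require Import boolp classical_sets.

(* Let nu : C (x) Hom_S(C, N) -> N and mu : F -> Hom_S(C, C (x) F) be the counit
   and unit.  Finite presentation makes mu bijective for F flat and nu bijective
   for N injective, so that N is in F_C(S) iff Hom_S(C, N) is flat and nu_N is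
   bijective, and dually M is in I_C(R) iff C (x) M is injective and mu_M is
   bijective.

   A pure monomorphism is characterized by solvability of finite systems of
   linear equations, and in this form purity visibly passes to Hom_S(C, -) (maps
   out of C are solutions of such a system) and to C (x) - (an equality of
   tensors involves finitely many relations).  Hence for N in F_C(S) the modules
   Hom_S(C, N') and Hom_S(C, N'') are flat; for M in I_C(R) with S left
   noetherian, Baer's criterion makes C (x) M' injective, so that C (x) X splits.

   It remains to compare X with C (x) Hom_S(C, X), resp. Hom_S(C, C (x) X).  The
   one nonformal point is that nu_{N''} is injective: Hom_S(C, ker nu_{N''}) = 0
   by the triangle identity, as mu is bijective on Hom_S(C, N'').  Dually
   C (x) mu_{M'} is surjective as nu is bijective on C (x) M', hence so is mu_{M'}. *)
Set Implicit Arguments.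
Unset Strict Implicit.
Unset Printing Implicit Defensive.

Import GRing.Theory.
Local Open Scope ring_scope.
Local Open Scope quotient_scope.

(** * Bundled maps, and submodules as predicates *)

Definition mk_linear (A : pzRingType) (M N : lmodType A) (f : M -> N)
    (fl : linear f) : {linear M -> N} :=
  HB.pack f (GRing.isLinear.Build A M N _ f fl).

Definition mk_additive (M N : zmodType) (f : M -> N)
    (fB : zmod_morphism f) : {additive M -> N} :=
  HB.pack f (GRing.isZmodMorphism.Build M N f fB).

Definition submodule (A : pzRingType) (V : lmodType A) (H : V -> Prop) : Prop :=
  [/\ H 0, forall x y, H x -> H y -> H (x + y) & forall a x, H x -> H (a *: x)].

Lemma linear_inj (A : pzRingType) (M N : lmodType A) (f : {linear M -> N}) :
  (forall x, f x = 0 -> x = 0) -> injective f.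
Proof.
by move=> f0 x y fxy; apply/subr0_eq/f0; rewrite linearB fxy subrr.
Qed.

(** * Quotients and submodules *)

Section Quotient.
Variables (A : pzRingType) (V : lmodType A) (H : V -> Prop).
Hypothesis subH : submodule H.

Let H0 : H 0. Proof. by case: subH. Qed.
Let HD x y : H x -> H y -> H (x + y). Proof. by case: subH => _ + _; apply. Qed.
Let HZ a x : H x -> H (a *: x). Proof. by case: subH => _ _; apply. Qed.
Let HN x : H x -> H (- x). Proof. by rewrite -scaleN1r; apply: HZ. Qed.

Let cong : rel V := fun x y => `[< H (x - y) >].

Let cong_refl : reflexive cong.
Proof. by move=> x; apply/asboolP; rewrite subrr. Qed.

Let cong_sym : symmetric cong.
Proof. by move=> x y; apply/asboolP/asboolP => /HN; rewrite opprB. Qed.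

Let cong_trans : transitive cong.
Proof.
move=> y x z /asboolP xy /asboolP yz; apply/asboolP.
by rewrite -(subrK y x) -addrA; apply: HD.
Qed.

Definition quotient_equiv := EquivRel cong cong_refl cong_sym cong_trans.

Definition quotient_module : Type := {eq_quot quotient_equiv}.

HB.instance Definition _ := Choice.copy quotient_module {eq_quot quotient_equiv}.

Definition to_quotient (x : V) : quotient_module :=
  \pi_({eq_quot quotient_equiv}) x.

Let q_repr (q : quotient_module) : V := repr (q : {eq_quot quotient_equiv}).

Let q_reprK q : to_quotient (q_repr q) = q.
Proof. exact: reprK. Qed.

Let to_quotientP x y : to_quotient x = to_quotient y <-> H (x - y).
Proof. by split=> [/eqmodP/asboolP|xy] //; apply/eqmodP/asboolP. Qed.

Let repr_to x : H (q_repr (to_quotient x) - x).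
Proof. by apply/to_quotientP; rewrite q_reprK. Qed.

Let qadd p q := to_quotient (q_repr p + q_repr q).
Let qopp q := to_quotient (- q_repr q).
Let qscale a q := to_quotient (a *: q_repr q).

Let qaddE x y : qadd (to_quotient x) (to_quotient y) = to_quotient (x + y).
Proof. by apply/to_quotientP; rewrite opprD addrACA; apply: HD. Qed.

Let qoppE x : qopp (to_quotient x) = to_quotient (- x).
Proof. by apply/to_quotientP; rewrite -opprD; apply: HN; apply: repr_to. Qed.

Let qscaleE a x : qscale a (to_quotient x) = to_quotient (a *: x).
Proof. by apply/to_quotientP; rewrite -scalerBr; apply: HZ. Qed.

Let qaddA : associative qadd.
Proof.
move=> p q r; rewrite -[p]q_reprK -[q]q_reprK -[r]q_reprK.
by rewrite !qaddE addrA.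
Qed.

Let qaddC : commutative qadd.
Proof. by move=> p q; rewrite /qadd addrC. Qed.

Let qadd0 : left_id (to_quotient 0) qadd.
Proof. by move=> q; rewrite -[q]q_reprK qaddE add0r. Qed.

Let qaddN : left_inverse (to_quotient 0) qopp qadd.
Proof. by move=> q; rewrite -[q]q_reprK qoppE qaddE addNr. Qed.

HB.instance Definition _ :=
  GRing.isZmodule.Build quotient_module qaddA qaddC qadd0 qaddN.

Let qscaleA a b q : qscale a (qscale b q) = qscale (a * b) q.
Proof. by rewrite -[q]q_reprK !qscaleE scalerA. Qed.

Let qscale1 : left_id 1 qscale.
Proof. by move=> q; rewrite -[q]q_reprK qscaleE scale1r. Qed.

Let qscaleDr : right_distributive qscale +%R.
Proof.
move=> a p q; rewrite -[p]q_reprK -[q]q_reprK -![_ + _]/(qadd _ _).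
by rewrite !(qscaleE, qaddE) scalerDr.
Qed.

Let qscaleDl q : {morph qscale^~ q : a b / a + b}.
Proof.
move=> a b; rewrite -[q]q_reprK -[RHS]/(qadd _ _).
by rewrite !(qscaleE, qaddE) scalerDl.
Qed.

HB.instance Definition _ := GRing.Zmodule_isLmodule.Build A quotient_module
  qscaleA qscale1 qscaleDr qscaleDl.

Let to_quotient_linear : linear to_quotient.
Proof.
move=> a x y; rewrite -[RHS]/(qadd (qscale a _) _).
by rewrite qscaleE qaddE.
Qed.

Lemma quotient_ex : exists (Q : lmodType A) (p : {linear V -> Q}),
  surjective p /\ forall x, p x = 0 <-> H x.
Proof.
exists quotient_module, (mk_linear to_quotient_linear); split=> [q|x].
  by exists (q_repr q); apply: q_reprK.
by rewrite -[x in H x]subr0; apply: to_quotientP.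
Qed.

End Quotient.

Section Submodule.
Variables (A : pzRingType) (V : lmodType A) (H : V -> Prop).
Hypothesis subH : submodule H.

Let mem : {pred V} := fun x => `[< H x >].

Let mem_submod : submod_closed mem.
Proof.
case: subH => H0 HD HZ; split=> [|a x y /asboolP Hx /asboolP Hy].
  exact/asboolP.
by apply/asboolP; apply: HD => //; apply: HZ.
Qed.

HB.instance Definition _ := GRing.isSubmodClosed.Build A V mem mem_submod.

Definition submodule_type : Type := {x : V | mem x}.
HB.instance Definition _ := SubChoice.copy submodule_type {x : V | mem x}.
HB.instance Definition _ := [SubChoice_isSubLmodule of submodule_type by <:].

Lemma submodule_ex : exists (K : lmodType A) (i : {linear K -> V}),
  injective i /\ forall x, H x <-> exists k, i k = x.
Proof.
exists submodule_type, (val : {linear submodule_type -> V}).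
split=> [|x]; first exact: val_inj.
split=> [Hx|[[y /= /asboolP Hy] <- //]].
have mx : mem x by apply/asboolP.
by exists (exist mem x mx : submodule_type).
Qed.

End Submodule.

Section Factor.
Variables (A : pzRingType) (M N Q : lmodType A).

(** A choice of preimages gives a set-theoretic section [s]; [h \o s] is linear because [h] is
    constant on the fibres of [p]. *)
Lemma lin_factor (p : {linear M -> Q}) (h : {linear M -> N}) :
    surjective p -> (forall x, p x = 0 -> h x = 0) ->
  exists g : {linear Q -> N}, forall x, g (p x) = h x.
Proof.
move=> /choice[s sK] ph.
have hs x : h (s (p x)) = h x.
  by apply/subr0_eq; rewrite -linearB ph // linearB sK subrr.
have gl : linear (h \o s).
  move=> a x y /=; rewrite -linearP -[in LHS](sK x) -[in LHS](sK y) -linearP.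
  exact: hs.
by exists (mk_linear gl) => x; apply: hs.
Qed.

Lemma lin_lift (i : {linear Q -> M}) (h : {linear N -> M}) :
    injective i -> (forall x, exists y, i y = h x) ->
  exists g : {linear N -> Q}, forall x, i (g x) = h x.
Proof.
move=> i_inj /choice[g gE].
have gl : linear g by move=> a x y; apply: i_inj; rewrite gE !linearP !gE.
by exists (mk_linear gl).
Qed.

End Factor.

Lemma image_submodule (A : pzRingType) (M N : lmodType A) (f : {linear M -> N}) :
  submodule (fun y => exists x, f x = y).
Proof.
split=> [|_ _ [x <-] [y <-]|a _ [x <-]]; first by exists 0; rewrite linear0.
  by exists (x + y); rewrite linearD.
by exists (a *: x); rewrite linearZ.
Qed.

Lemma kernel_submodule (A : pzRingType) (M N : lmodType A) (f : {linear M -> N}) :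
  submodule (fun x => f x = 0).
Proof.
split=> [|x y fx fy|a x fx]; first exact: linear0.
  by rewrite linearD fx fy addr0.
by rewrite linearZ fx; apply: scaler0.
Qed.

(** Extension along a map that need not be injective: [b] and [h] both factor through M / ker b, on
    which [b] becomes injective. *)
Lemma injective_extend (A : pzRingType) (I M N : lmodType A)
    (b : {linear M -> N}) (h : {linear M -> I}) :
    injective_module I -> (forall x, b x = 0 -> h x = 0) ->
  exists g : {linear N -> I}, forall x, g (b x) = h x.
Proof.
move=> injI bh.
have [Q [p [p_surj pE]]] := quotient_ex (kernel_submodule b).
have [b' b'E] : exists b' : {linear Q -> N}, forall x, b' (p x) = b x.
  by apply: lin_factor => // x /pE.
have [h' h'E] : exists h' : {linear Q -> I}, forall x, h' (p x) = h x.
  by apply: lin_factor => // x /pE/bh.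
have b'_inj : injective b'.
  apply: linear_inj => q; have [x <-] := p_surj q.
  by rewrite b'E => /pE.
have [g gE] := injI _ _ b' h' b'_inj.
by exists g => x; rewrite -b'E -h'E; apply: gE.
Qed.

(** * Tensor products and flatness *)

Section TensorTheory.
Variables (A : pzRingType) (M : lmodType A^c) (F : lmodType A).

Lemma tensor_of_sum (s : seq (M * F)) :
  tensor_of s = \sum_(p <- s) pure_tensor p.1 p.2.
Proof.
elim: s => [|[m x] s IHs]; first by rewrite big_nil.
by rewrite big_cons -IHs -tensor_of_cat.
Qed.

Lemma tensor_elim (P : tensor M F -> Prop) :
    P 0 -> (forall t u, P t -> P u -> P (t + u)) ->
    (forall m x, P (pure_tensor m x)) ->
  forall t, P t.
Proof.
move=> P0 PD Ppure t; rewrite -[t]tensor_reprK tensor_of_sum.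
by elim/big_ind: _.
Qed.

Lemma pure_additivel (x : F) :
  zmod_morphism (fun m : M => pure_tensor m x).
Proof.
move=> m m'; apply/eqP; rewrite eq_sym subr_eq; apply/eqP.
rewrite -tensor_of_cat -{1}(subrK m' m); apply/tensor_ofP.
exact: tensor_rel_addl.
Qed.

Lemma pure_additiver (m : M) :
  zmod_morphism (fun x : F => pure_tensor m x).
Proof.
move=> x x'; apply/eqP; rewrite eq_sym subr_eq; apply/eqP.
rewrite -tensor_of_cat -{1}(subrK x' x); apply/tensor_ofP.
exact: tensor_rel_addr.
Qed.

Lemma pure_tensor_suml I (r : seq I) (P : pred I) (G : I -> M) (x : F) :
  pure_tensor (\sum_(i <- r | P i) G i) x = \sum_(i <- r | P i) pure_tensor (G i) x.
Proof. exact: (raddf_sum (mk_additive (pure_additivel x))). Qed.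

Lemma pure_tensor_sumr I (r : seq I) (P : pred I) (G : I -> F) (m : M) :
  pure_tensor m (\sum_(i <- r | P i) G i) = \sum_(i <- r | P i) pure_tensor m (G i).
Proof. exact: (raddf_sum (mk_additive (pure_additiver m))). Qed.

Lemma pure_tensor0l (x : F) : pure_tensor (0 : M) x = 0 :> tensor M F.
Proof. exact: (raddf0 (mk_additive (pure_additivel x))). Qed.

Lemma pure_tensor0r (m : M) : pure_tensor m (0 : F) = 0 :> tensor M F.
Proof. exact: (raddf0 (mk_additive (pure_additiver m))). Qed.

Lemma pure_tensorDl (m m' : M) (x : F) :
  pure_tensor (m + m') x = pure_tensor m x + pure_tensor m' x :> tensor M F.
Proof. exact: (raddfD (mk_additive (pure_additivel x))). Qed.

Lemma pure_tensorDr (m : M) (x x' : F) :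
  pure_tensor m (x + x') = pure_tensor m x + pure_tensor m x' :> tensor M F.
Proof. exact: (raddfD (mk_additive (pure_additiver m))). Qed.

Lemma pure_tensor_bal (m : M) (a : A) (x : F) :
  pure_tensor ((a : A^c) *: m) x = pure_tensor m (a *: x) :> tensor M F.
Proof. exact/tensor_ofP/tensor_rel_bal. Qed.

(** The universal property of the tensor product: summing [phi] over a formal sum respects each
    generating relation. *)
Lemma tensor_lift (D : zmodType) (phi : M -> F -> D) :
    (forall x, zmod_morphism (phi^~ x)) -> (forall m, zmod_morphism (phi m)) ->
    (forall m (a : A) x, phi ((a : A^c) *: m) x = phi m (a *: x)) ->
  exists Phi : {additive tensor M F -> D},
    forall m x, Phi (pure_tensor m x) = phi m x.
Proof.
move=> phil phir phib; pose ev (s : seq (M * F)) := \sum_(p <- s) phi p.1 p.2.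
have evE s t : tensor_rel s t -> ev s = ev t.
  elim=> {s t}.
  - by [].
  - by [].
  - by move=> s t u _ -> _ ->.
  - by move=> s s' t t' _ ss' _ tt'; rewrite /ev !big_cat /= -/(ev s) ss' -/(ev t) tt'.
  - by move=> s t; rewrite /ev !big_cat /= addrC.
  - by move=> x; rewrite /ev big_seq1 big_nil; apply: (raddf0 (mk_additive (phil x))).
  - move=> m m' x; rewrite /ev !big_cons !big_nil !addr0 /=.
    exact: (raddfD (mk_additive (phil x))).
  - move=> m x x'; rewrite /ev !big_cons !big_nil !addr0 /=.
    exact: (raddfD (mk_additive (phir m))).
  - by move=> m a x; rewrite /ev !big_seq1 phib.
have ev_of s : ev (tensor_repr (tensor_of s)) = ev s.
  exact/evE/tensor_repr_of.
have evD t u : ev (tensor_repr (t + u)) = ev (tensor_repr t) + ev (tensor_repr u).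
  have -> : t + u = tensor_of (tensor_repr t ++ tensor_repr u).
    by rewrite tensor_of_cat !tensor_reprK.
  by rewrite ev_of /ev big_cat.
have evB : zmod_morphism (fun t => ev (tensor_repr t)).
  by move=> t u; apply: (addIr (ev (tensor_repr u))); rewrite -evD !subrK.
exists (mk_additive evB) => m x.
by rewrite [LHS]ev_of /ev big_seq1.
Qed.

End TensorTheory.

Section TensorFunctor.
Variables (A : pzRingType).

Lemma tensor_map_comp (M M' M'' : lmodType A^c) (F F' F'' : lmodType A)
    (f : {linear M -> M'}) (f' : {linear M' -> M''})
    (g : {linear F -> F'}) (g' : {linear F' -> F''}) t :
  tensor_map f' g' (tensor_map f g t) = tensor_map (f' \o f) (g' \o g) t.
Proof.
rewrite -[t]tensor_reprK !tensor_map_of -map_comp.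
by congr (tensor_of _); apply: eq_map.
Qed.

Lemma eq_tensor_map (M M' : lmodType A^c) (F F' : lmodType A)
    (f f' : {linear M -> M'}) (g g' : {linear F -> F'}) :
  f =1 f' -> g =1 g' -> tensor_map f g =1 tensor_map f' g'.
Proof.
move=> ff' gg' t; congr (tensor_of _); apply: eq_map => p.
by rewrite ff' gg'.
Qed.

Lemma tensor_map_id (M : lmodType A^c) (F : lmodType A) (t : tensor M F) :
  tensor_map idfun idfun t = t.
Proof.
rewrite -[t]tensor_reprK tensor_map_of; congr (tensor_of _).
by rewrite -[RHS]map_id; apply: eq_map => -[].
Qed.

Lemma tensor_map_surj (M M' : lmodType A^c) (F F' : lmodType A)
    (f : {linear M -> M'}) (g : {linear F -> F'}) :
    surjective f -> surjective g -> surjective (tensor_map f g).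
Proof.
move=> fs gs; apply: tensor_elim => [|t u [t' <-] [u' <-]|m x].
- by exists 0; rewrite raddf0.
- by exists (t' + u'); rewrite raddfD.
have [[m' <-] [x' <-]] := (fs m, gs x).
by exists (pure_tensor m' x'); rewrite tensor_map_pure.
Qed.

(* The kernel of f (x) g is generated by ker f (x) F and M (x) ker g: along a
   chain of generating relations, lifts of the two ends differ by an element
   of that subgroup. *)
Lemma tensor_map_ker (M M' : lmodType A^c) (F F' : lmodType A)
    (f : {linear M -> M'}) (g : {linear F -> F'}) (H : tensor M F -> Prop) :
    surjective f -> surjective g ->
    H 0 -> (forall t u, H t -> H u -> H (t + u)) -> (forall t, H t -> H (- t)) ->
    (forall m x, f m = 0 \/ g x = 0 -> H (pure_tensor m x)) ->
  forall t, tensor_map f g t = 0 -> H t.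
Proof.
move=> fs gs H0 HD HN Hpure.
pose fg (s : seq (M * F)) := [seq (f p.1, g p.2) | p <- s].
have fg_surj s' : exists s, fg s = s'.
  elim: s' => [|[m' x'] s' [s <-]]; first by exists [::].
  have [[m <-] [x <-]] := (fs m', gs x').
  by exists ((m, x) :: s).
have Hpure2 m m' x x' : f m = f m' -> g x = g x' ->
    H (pure_tensor m x - pure_tensor m' x').
  move=> fm gx; rewrite -(subrK (pure_tensor m' x) (pure_tensor m x)) -addrA.
  apply: (HD).
    rewrite -[_ - _](pure_additivel x); apply: Hpure; left.
    by rewrite linearB fm subrr.
  rewrite -[_ - _](pure_additiver m'); apply: Hpure; right.
  by rewrite linearB gx subrr.
have H2 t u t' u' : H (t - t') -> H (u - u') -> H ((t + u) - (t' + u')).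
  by move=> Ht Hu; rewrite opprD addrACA; apply: (HD).
have Hrefl s t : fg s = fg t -> H (tensor_of s - tensor_of t).
  elim: s t => [|[m x] s IHs] [|[m' x'] t] //=; first by rewrite subrr.
  case=> fm gx /IHs Hst; rewrite -cat1s -[(m', x') :: t]cat1s !tensor_of_cat.
  by apply: H2 => //; apply: Hpure2.
have main s' t' : tensor_rel s' t' ->
    forall s t, fg s = s' -> fg t = t' -> H (tensor_of s - tensor_of t).
  elim=> {s' t'}.
  - by move=> s' s t <- /esym; apply: Hrefl.
  - by move=> s' t' _ IH s t ss tt; rewrite -opprB; apply/HN/IH.
  - move=> s' t' u' _ IH1 _ IH2 s u ss' uu'; have [t tt'] := fg_surj t'.
    rewrite -(subrK (tensor_of t) (tensor_of s)) -addrA.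
    by apply: (HD); [apply: IH1 | apply: IH2].
  (* The induction hypotheses speak of lifts of the four pieces, so [s] and [t] are first replaced
     by concatenations of such lifts, at the cost of elements of [H] ([Hrefl]). *)
  - move=> s1 s2 t1 t2 _ IH1 _ IH2 s t ss tt.
    have [[a aE] [b bE]] := (fg_surj s1, fg_surj t1).
    have [[c cE] [d dE]] := (fg_surj s2, fg_surj t2).
    have Hs : H (tensor_of s - tensor_of (a ++ b)).
      by apply: Hrefl; rewrite ss /fg map_cat -/(fg a) -/(fg b) aE bE.
    have Ht : H (tensor_of (c ++ d) - tensor_of t).
      by apply: Hrefl; rewrite tt /fg map_cat -/(fg c) -/(fg d) cE dE.
    rewrite -(subrK (tensor_of (a ++ b)) (tensor_of s)) -addrA; apply: (HD) => //.
    rewrite -(subrK (tensor_of (c ++ d)) (tensor_of (a ++ b))) -addrA.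
    apply: (HD) => //.
    by rewrite !tensor_of_cat; apply: (H2); [apply: IH1 | apply: IH2].
  - move=> s1 s2 s t ss tt; have [[a aE] [b bE]] := (fg_surj s1, fg_surj s2).
    have Hs : H (tensor_of s - tensor_of (a ++ b)).
      by apply: Hrefl; rewrite ss /fg map_cat -/(fg a) -/(fg b) aE bE.
    have Ht : H (tensor_of (b ++ a) - tensor_of t).
      by apply: Hrefl; rewrite tt /fg map_cat -/(fg a) -/(fg b) aE bE.
    rewrite -(subrK (tensor_of (a ++ b)) (tensor_of s)) -addrA; apply: (HD) => //.
    by rewrite tensor_of_cat (addrC (tensor_of a)) -(tensor_of_cat b a).
  - rewrite /fg => x' [|[m x] [|? ?]] [|? ?] //= [fm _] _.
    by rewrite subr0; apply: Hpure; left.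
  - rewrite /fg => m1 m2 x' [|[a x] [|? ?]] [|[b y] [|[c z] [|? ?]]] //=.
    case=> fa gx [fb gy fc gz].
    rewrite -[tensor_of [:: (b, y); _]]/(tensor_of ([:: (b, y)] ++ [:: (c, z)])).
    rewrite tensor_of_cat -[tensor_of [:: (a, x)]]/(pure_tensor a x).
    rewrite -(subrK (pure_tensor (b + c) x) (pure_tensor a x)) -addrA.
    apply: (HD); first by apply: (Hpure2); rewrite // linearD fa fb fc.
    by rewrite pure_tensorDl; apply: (H2); apply: (Hpure2); rewrite // gx.
  - rewrite /fg => m' x1 x2 [|[a x] [|? ?]] [|[b y] [|[c z] [|? ?]]] //=.
    case=> fa gx [fb gy fc gz].
    rewrite -[tensor_of [:: (b, y); _]]/(tensor_of ([:: (b, y)] ++ [:: (c, z)])).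
    rewrite tensor_of_cat -[tensor_of [:: (a, x)]]/(pure_tensor a x).
    rewrite -(subrK (pure_tensor a (y + z)) (pure_tensor a x)) -addrA.
    apply: (HD); first by apply: (Hpure2); rewrite // linearD gx gy gz.
    by rewrite pure_tensorDr; apply: (H2); apply: (Hpure2); rewrite // fa.
  - rewrite /fg => m' a x' [|[m x] [|? ?]] [|[n y] [|? ?]] //= [fm gx] [fn gy].
    rewrite -[tensor_of [:: (m, x)]]/(pure_tensor m x).
    rewrite -[tensor_of [:: (n, y)]]/(pure_tensor n y).
    rewrite -(subrK (pure_tensor ((a : A^c) *: n) x) (pure_tensor m x)) -addrA.
    apply: (HD); first by apply: (Hpure2); rewrite // fm linearZ fn.
    by rewrite pure_tensor_bal; apply: (Hpure2); rewrite // linearZ gx gy.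
move=> t; rewrite -[t]tensor_reprK tensor_map_of => /tensor_ofP ft.
by rewrite -[tensor_of _]subr0; apply: (main _ _ ft).
Qed.

Lemma tensor_exactl (L M N : lmodType A^c) (F : lmodType A)
    (f : {linear L -> M}) (g : {linear M -> N}) :
    exact_at f g -> surjective g ->
  exact_at (tensor_map f (@idfun F)) (tensor_map g (@idfun F)).
Proof.
move=> fg gs t; split=> [gt|[u <-]].
  apply: (tensor_map_ker (f := g) (g := @idfun F)
    (H := fun t => exists u, tensor_map f idfun u = t)) gt => //.
  - by move=> x; exists x.
  - by exists 0; rewrite raddf0.
  - by move=> _ _ [u <-] [v <-]; exists (u + v); rewrite raddfD.
  - by move=> _ [u <-]; exists (- u); rewrite raddfN.
  move=> m x [/fg[l <-]|/= ->].
    by exists (pure_tensor l x); rewrite tensor_map_pure.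
  by exists 0; rewrite raddf0 pure_tensor0r.
move: u; apply: tensor_elim => [|u v|l x]; first by rewrite !raddf0.
  by move=> gu gv; rewrite !raddfD /= gu gv addr0.
rewrite !tensor_map_pure; have /fg-> : exists l', f l' = f l by exists l.
exact: pure_tensor0l.
Qed.

Lemma tensor_exactr (B : lmodType A^c) (L M N : lmodType A)
    (f : {linear L -> M}) (g : {linear M -> N}) :
    exact_at f g -> surjective g ->
  exact_at (tensor_map (@idfun B) f) (tensor_map (@idfun B) g).
Proof.
move=> fg gs t; split=> [gt|[u <-]].
  apply: (tensor_map_ker (f := @idfun B) (g := g)
    (H := fun t => exists u, tensor_map idfun f u = t)) gt => //.
  - by move=> x; exists x.
  - by exists 0; rewrite raddf0.
  - by move=> _ _ [u <-] [v <-]; exists (u + v); rewrite raddfD.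
  - by move=> _ [u <-]; exists (- u); rewrite raddfN.
  move=> b x [/= ->|/fg[l <-]].
    by exists 0; rewrite raddf0 pure_tensor0l.
  by exists (pure_tensor b l); rewrite tensor_map_pure.
move: u; apply: tensor_elim => [|u v|b l]; first by rewrite !raddf0.
  by move=> gu gv; rewrite !raddfD /= gu gv addr0.
rewrite !tensor_map_pure; have /fg-> : exists l', f l' = f l by exists l.
exact: pure_tensor0r.
Qed.

(* Only finitely many linear relations between elements of F are involved in an
   equality of tensors; any map that preserves them preserves the equality. *)
Lemma tensor_rel_local (B : lmodType A^c) (F : lmodType A) (s t : seq (B * F)) :
    tensor_rel s t ->
  exists E : seq (seq (A * F)),
    (forall e, e \in E -> \sum_(p <- e) p.1 *: p.2 = 0) /\
    forall (G : lmodType A) (phi : F -> G),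
      (forall e, e \in E -> \sum_(p <- e) p.1 *: phi p.2 = 0) ->
    tensor_rel [seq (p.1, phi p.2) | p <- s] [seq (p.1, phi p.2) | p <- t].
Proof.
elim=> {s t}.
- by move=> s; exists [::]; split=> // G phi _; apply: tensor_rel_refl.
- move=> s t _ [E [E0 IH]]; exists E; split=> // G phi /IH.
  exact: tensor_rel_sym.
- move=> s t u _ [E [E0 IH]] _ [E' [E'0 IH']]; exists (E ++ E'); split=> [e|G phi EE'].
    by rewrite mem_cat => /orP[/E0|/E'0].
  have st : tensor_rel [seq (p.1, phi p.2) | p <- s] [seq (p.1, phi p.2) | p <- t].
    by apply: IH => e eE; apply: EE'; rewrite mem_cat eE.
  by apply: tensor_rel_trans st (IH' _ _ _) => e eE; apply: EE'; rewrite mem_cat eE orbT.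
- move=> s s' t t' _ [E [E0 IH]] _ [E' [E'0 IH']]; exists (E ++ E').
  split=> [e|G phi EE'].
    by rewrite mem_cat => /orP[/E0|/E'0].
  rewrite !map_cat; apply: tensor_rel_cat.
    by apply: IH => e eE; apply: EE'; rewrite mem_cat eE.
  by apply: IH' => e eE; apply: EE'; rewrite mem_cat eE orbT.
- move=> s t; exists [::]; split=> // G phi _; rewrite !map_cat.
  exact: tensor_rel_comm.
- by move=> x; exists [::]; split=> // G phi _; apply: tensor_rel_zero.
- by move=> m m' x; exists [::]; split=> // G phi _; apply: tensor_rel_addl.
(* [phi] is a bare function, so its additivity at [x] and [x'] is imposed through the linear
   relation (x + x') - x - x' = 0. *)
- move=> m x x'; exists [:: [:: (1, x + x'); (-1, x); (-1, x')]].
  split=> [e|G phi /(_ _ (mem_head _ _))].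
    rewrite inE => /eqP->; rewrite !big_cons big_nil /= !scaleN1r scale1r addr0.
    by rewrite -opprD subrr.
  rewrite !big_cons big_nil /= !scaleN1r scale1r addr0 -opprD => /subr0_eq ->.
  exact: tensor_rel_addr.
- move=> m a x; exists [:: [:: (1, a *: x); (- a, x)]].
  split=> [e|G phi /(_ _ (mem_head _ _))].
    by rewrite inE => /eqP->; rewrite !big_cons big_nil /= scaleNr scale1r addr0 subrr.
  rewrite !big_cons big_nil /= scaleNr scale1r addr0 => /subr0_eq ->.
  exact: tensor_rel_bal.
Qed.

End TensorFunctor.

Section FlatExact.
Variables (A : pzRingType) (F : lmodType A).
Hypothesis flatF : flat F.

(** The cokernel of [f] completes it to a short exact sequence, to which flatness applies. *)
Lemma flat_inj (L M : lmodType A^c) (f : {linear L -> M}) :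
  injective f -> injective (tensor_map f (@idfun F)).
Proof.
move=> f_inj; have [Q [p [ps pE]]] := quotient_ex (image_submodule f).
by have [] := flatF (f := f) (g := p) _; first by split=> // y; apply: pE.
Qed.

(** By exactness [g] is the projection onto coker f followed by an injective map, and the latter
    stays injective after tensoring with [F]. *)
Lemma flat_exact (L M N : lmodType A^c) (f : {linear L -> M}) (g : {linear M -> N}) :
  exact_at f g -> exact_at (tensor_map f (@idfun F)) (tensor_map g (@idfun F)).
Proof.
move=> fg; have [Q [p [ps pE]]] := quotient_ex (image_submodule f).
have [g' g'E] : exists g' : {linear Q -> N}, forall x, g' (p x) = g x.
  by apply: lin_factor => // x /pE/fg.
have g'_inj : injective g'.
  by apply: linear_inj => q; have [x <-] := ps q; rewrite g'E => /fg/pE.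
move=> t; have fp : exact_at f p by move=> y; apply: pE.
rewrite -(tensor_exactl fp ps t).
have -> : tensor_map g (@idfun F) t = tensor_map g' idfun (tensor_map p idfun t).
  by rewrite tensor_map_comp; apply: eq_tensor_map => x //=; rewrite g'E.
split=> [|->]; last exact: raddf0.
by rewrite -[X in _ = X](raddf0 (tensor_map g' (@idfun F))) => /(flat_inj g'_inj).
Qed.

End FlatExact.

(** Tensoring is right exact, so only injectivity on the left is at stake. *)
Lemma flat_of_inj (A : pzRingType) (F : lmodType A) :
    (forall (L M : lmodType A^c) (f : {linear L -> M}) (N : lmodType A^c)
        (g : {linear M -> N}), short_exact f g ->
      injective (tensor_map f (@idfun F))) ->
  flat F.
Proof.
move=> Finj L M N f g fgse; have [fi fg gs] := fgse.
split; first exact: (Finj _ _ _ _ _ fgse).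
  exact: tensor_exactl.
by apply: tensor_map_surj => // x; exists x.
Qed.

Lemma flat_iso (A : pzRingType) (F F' : lmodType A) :
  lmod_iso F F' -> flat F -> flat F'.
Proof.
move=> [u [v uK vK]] flatF.
have vl : linear v by apply: can2_linear uK vK.
pose v' := mk_linear vl.
apply: flat_of_inj => L M f N g [fi _ _].
have natv t : tensor_map (@idfun M) v' (tensor_map f (@idfun F') t) =
    tensor_map f (@idfun F) (tensor_map (@idfun L) v' t).
  by rewrite !tensor_map_comp; apply: eq_tensor_map.
have vtK : cancel (tensor_map (@idfun L) v') (tensor_map (@idfun L) u).
  move=> t; rewrite tensor_map_comp -[RHS]tensor_map_id.
  by apply: eq_tensor_map.
move=> t t' /(congr1 (tensor_map (@idfun M) v')).
by rewrite !natv => /(flat_inj flatF fi)/(can_inj vtK).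
Qed.

(** * Purity as solvability of linear equations *)

Lemma hom_evalB (A : pzRingType) (M N : lmodType A) (x : M) :
  zmod_morphism (fun h : lmodHom M N => h x).
Proof. by []. Qed.

Lemma hom_sumE (A : pzRingType) (M N : lmodType A) I (r : seq I) (P : pred I)
    (h : I -> lmodHom M N) x :
  (\sum_(i <- r | P i) h i) x = \sum_(i <- r | P i) h i x.
Proof. exact: (raddf_sum (mk_additive (@hom_evalB A M N x))). Qed.

Section BihomMap.
Variables (S R : pzRingType) (C : bimodType S R) (N N' : lmodType S).
Variable g : {linear N -> N'}.

Let bihom_map_fun (h : bihom C N) : bihom C N' := g \o h.

Let bihom_map_linear : linear bihom_map_fun.
Proof. by move=> r h h'; apply: hom_ext => x; apply: linearD. Qed.

Definition bihom_map : {linear bihom C N -> bihom C N'} :=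
  mk_linear bihom_map_linear.

Lemma bihom_mapE h x : bihom_map h x = g (h x).
Proof. by []. Qed.

End BihomMap.

Section BitensorMap.
Variables (S R : pzRingType) (C : bimodType S R) (F F' : lmodType R).
Variable g : {linear F -> F'}.

Let bitensor_map_fun : bitensor C F -> bitensor C F' :=
  tensor_map (@idfun (rightmod C)) g.

Let bitensor_map_linear : linear bitensor_map_fun.
Proof.
move=> s t u; rewrite [LHS]raddfD; congr (_ + _).
rewrite [LHS]tensor_map_comp [RHS]tensor_map_comp.
exact: eq_tensor_map.
Qed.

Definition bitensor_map : {linear bitensor C F -> bitensor C F'} :=
  mk_linear bitensor_map_linear.

Lemma bitensor_mapE t : bitensor_map t = tensor_map (@idfun (rightmod C)) g t.
Proof. by []. Qed.

End BitensorMap.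

Lemma bitensor_scale_of (S R : pzRingType) (C : bimodType S R) (F : lmodType R)
    (s : S) (l : seq (rightmod C * F)) :
  s *: (tensor_of l : bitensor C F) = tensor_of [seq (lmul s p.1, p.2) | p <- l].
Proof. exact: tensor_map_of. Qed.

Lemma bitensor_scale_pure (S R : pzRingType) (C : bimodType S R) (F : lmodType R)
    (s : S) (c : rightmod C) (x : F) :
  s *: (pure_tensor c x : bitensor C F) = pure_tensor (lmul s c) x.
Proof. exact: bitensor_scale_of. Qed.

(* Purity in terms of systems of linear equations: finitely many equations with
   right-hand sides in the submodule N', solved by elements of N, are solved by
   the images of these elements under some map phi to N'. *)
Definition local_pure (A : pzRingType) (N' N : lmodType A)
    (f : {linear N' -> N}) : Prop :=
  forall L : seq (seq (A * N) * N'),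
    (forall c, c \in L -> \sum_(p <- c.1) p.1 *: p.2 = f c.2) ->
  exists phi : N -> N',
    forall c, c \in L -> \sum_(p <- c.1) p.1 *: phi p.2 = c.2.

Section LocalPure.
Variables (A : pzRingType) (N' N : lmodType A) (f : {linear N' -> N}).

(** A local retraction of [f]: the relations in [E] enter the system with right-hand side 0, and
    [phi (f y) = y] enters as an equation with the single coefficient 1. *)
Lemma local_pure_retract : local_pure f ->
  forall (E : seq (seq (A * N))) (Y : seq N'),
    (forall e, e \in E -> \sum_(p <- e) p.1 *: p.2 = 0) ->
  exists phi : N -> N',
    (forall e, e \in E -> \sum_(p <- e) p.1 *: phi p.2 = 0) /\
    forall y, y \in Y -> phi (f y) = y.
Proof.
move=> pf E Y E0.
have [|phi phiE] := pf ([seq (e, 0) | e <- E] ++ [seq ([:: (1, f y)], y) | y <- Y]).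
  move=> c; rewrite mem_cat => /orP[] /mapP[z zE -> /=].
    by rewrite linear0 E0.
  by rewrite big_seq1 scale1r.
exists phi; split=> [e eE|y yY].
  by apply: (phiE (e, 0)); rewrite mem_cat map_f.
have /phiE : ([:: (1, f y)], y) \in [seq (e, 0) | e <- E] ++ [seq ([:: (1, f y)], y) | y <- Y].
  by rewrite mem_cat orbC (map_f (fun y => ([:: (1, f y)], y)) yY).
by rewrite /= big_seq1 scale1r.
Qed.

(** If a tensor dies under [f], finitely many relations in [N] are responsible. A local retraction
    preserves them and undoes [f] on the second components, so the tensor was already 0. *)
Lemma local_pure_tensor (B : lmodType A^c) :
  local_pure f -> injective (tensor_map (@idfun B) f).
Proof.
move=> pf; apply: raddf_inj => t /=; rewrite -[t]tensor_reprK tensor_map_of.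
move: (tensor_repr t) => s /(@tensor_ofP _ _ _ _ [::])/tensor_rel_local[E [E0 Erel]].
have [phi [phiE phiY]] := local_pure_retract pf [seq p.2 | p <- s] E0.
have := Erel _ _ phiE; rewrite -map_comp => /tensor_ofP /= s0; apply: etrans s0.
congr (tensor_of _); rewrite -[LHS]map_id; apply/eq_in_map => -[b y] bys /=.
by rewrite phiY //; apply/mapP; exists (b, y).
Qed.

End LocalPure.

Lemma additive_zlinear (M N : lmodType int) (f : M -> N) :
  zmod_morphism f -> linear f.
Proof.
move=> fB a x y; rewrite -[a]intz !scaler_int.
by rewrite -[f]/(mk_additive fB : _ -> _) raddfD raddfMz.
Qed.

Lemma subgroup_submodule (V : zmodType) (H : V -> Prop) :
    H 0 -> (forall x y, H x -> H y -> H (x + y)) -> (forall x, H x -> H (- x)) ->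
  submodule (H : zmodule V -> Prop).
Proof.
move=> H0 HD HN; split=> // a x Hx; rewrite -[a]intz scaler_int.
have Hn n : H (x *+ n) by elim: n => // n IHn; rewrite mulrS; apply: HD.
by case: a => n; [apply: Hn | apply/HN/Hn].
Qed.

(* An A-module as an (int, A^c)-bimodule, so that [bihom (int_bimod N) D] is the
   right A-module Hom_Z(N, D). *)
Definition int_bimod (A : pzRingType) (N : lmodType A) : Type := zmodule N.

Section IntBimod.
Variables (A : pzRingType) (N : lmodType A).

HB.instance Definition _ := GRing.Lmodule.copy (int_bimod N) (zmodule N).

Let iact (x : int_bimod N) (a : A^c) : int_bimod N := (a : A) *: (x : N).

Let iactDl (a : A^c) x y : iact (x + y) a = iact x a + iact y a.
Proof. exact: (@scalerDr A N). Qed.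

Let iactDr x (a b : A^c) : iact x (a + b) = iact x a + iact x b.
Proof. exact: (@scalerDl A N). Qed.

Let iact1 x : iact x 1 = x.
Proof. exact: (@scale1r A N). Qed.

Let iactA x (a b : A^c) : iact (iact x a) b = iact x (a * b).
Proof. by rewrite /iact (@scalerA A N). Qed.

Let iactZ (n : int) x (a : A^c) : iact (n *: x) a = n *: iact x a.
Proof.
rewrite -[n]intz !scaler_int.
exact: (raddfMz (GRing.scale (a : A) : {additive N -> N})).
Qed.

HB.instance Definition _ := Lmodule_isBimodule.Build int A^c (int_bimod N)
  iactDl iactDr iact1 iactA iactZ.

End IntBimod.

(** The terms are grouped by second component; each group is a pure tensor whose first component is
    0. *)
Lemma tensor_of_collect (A : pzRingType) (M : lmodType A^c) (F : lmodType A)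
    (s : seq (M * F)) :
  (forall z, \sum_(p <- s | p.2 == z) p.1 = 0) -> tensor_of s = 0.
Proof.
move=> s0; rewrite tensor_of_sum; set u := undup [seq p.2 | p <- s].
transitivity (\sum_(z <- u) \sum_(p <- s | p.2 == z) pure_tensor p.1 p.2).
  under [RHS]eq_bigr do rewrite big_mkcond.
  rewrite exchange_big /= big_seq [RHS]big_seq; apply: eq_bigr => p ps.
  rewrite (bigD1_seq p.2) ?undup_uniq ?mem_undup ?map_f //= eqxx.
  by rewrite big1 ?addr0 // => z; rewrite eq_sym => /negPf->.
rewrite big1 // => z _; rewrite -[RHS](pure_tensor0l M z) -(s0 z) pure_tensor_suml.
by apply: eq_bigr => p /eqP->.
Qed.

Section FfunModule.
Variables (A : pzRingType) (M : lmodType A) (I : finType).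

Let proj_fun i (c : {ffun I -> M}) : M := c i.
Let proj_linear i : linear (proj_fun i).
Proof. by move=> a c d; rewrite /proj_fun !ffunE. Qed.
Definition ffun_proj i : {linear {ffun I -> M} -> M} := mk_linear (proj_linear i).

Let incl_fun i (x : M) : {ffun I -> M} := [ffun j => x *+ (j == i)].
Let incl_linear i : linear (incl_fun i).
Proof.
move=> a x y; apply/ffunP => j; rewrite /incl_fun !ffunE.
by rewrite mulrnDl scalerMnr.
Qed.
Definition ffun_incl i : {linear M -> {ffun I -> M}} := mk_linear (incl_linear i).

Lemma ffun_inclE i x j : ffun_incl i x j = x *+ (j == i).
Proof. exact: ffunE. Qed.

Lemma ffun_proj_incl i j x : ffun_proj j (ffun_incl i x) = x *+ (j == i).
Proof. exact: ffunE. Qed.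

Lemma ffun_sum_incl (c : {ffun I -> M}) : c = \sum_i ffun_incl i (c i).
Proof.
apply/ffunP => j; rewrite sum_ffunE (bigD1 j) //= ffun_inclE eqxx mulr1n.
by rewrite big1 ?addr0 // => i /negPf ij; rewrite ffun_inclE eq_sym ij.
Qed.

End FfunModule.

Section PureLocal.
Variables (A : pzRingType) (N' N : lmodType A) (f : {linear N' -> N}).

(* Testing against B = Hom_Z(N', D), where D is the group of right-hand sides
   modulo those of the form [res phi]. *)
Lemma tensor_local_pure :
  (forall B : lmodType A^c, injective (tensor_map (@idfun B) f)) -> local_pure f.
Proof.
move=> finj L LE; set m := size L.
pose l (i : 'I_m) := tnth (in_tuple L) i.
have lL i : l i \in L by apply: mem_tnth.
(* The system is solvable in [N'] exactly when the vector of its right-hand sides lies in [H]. *)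
pose res (phi : N -> N') : {ffun 'I_m -> N'} :=
  [ffun i => \sum_(p <- (l i).1) p.1 *: phi p.2].
pose H (v : {ffun 'I_m -> N'}) := exists phi, res phi = v.
have subH : submodule (H : zmodule {ffun 'I_m -> N'} -> Prop).
  apply: subgroup_submodule.
  - exists (fun=> 0); apply/ffunP => i; rewrite !ffunE.
    by rewrite big1 // => p _; rewrite scaler0.
  - move=> _ _ [phi <-] [psi <-]; exists (fun z => phi z + psi z).
    apply/ffunP => i; rewrite !ffunE -big_split.
    by apply: eq_bigr => p _; rewrite scalerDr.
  - move=> _ [phi <-]; exists (fun z => - phi z).
    apply/ffunP => i; rewrite !ffunE -sumrN.
    by apply: eq_bigr => p _; rewrite scalerN.
have [D [pi [_ piE]]] := quotient_ex subH.
pose incl (i : 'I_m) := ffun_incl N' i.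
have epsl i : linear (fun y : int_bimod N' => pi (incl i y)).
  by apply: additive_zlinear => x y; rewrite -[RHS]linearB; congr (pi _); rewrite linearB.
pose eps i : bihom (int_bimod N') D := mk_linear (epsl i).
have [ev evE] : exists ev : {additive tensor (bihom (int_bimod N') D) N' -> D},
    forall b y, ev (pure_tensor b y) = b y.
  by apply: tensor_lift => [y b b'|b x y|b a y] //; apply: (raddfB b).
(* Evaluation sends [T] to the class in [D] of the vector of right-hand sides, so [T = 0] yields a
   solution. *)
pose T := \sum_i pure_tensor (eps i) ((l i).2 : N').
suff T0 : T = 0.
  have : pi (\sum_i incl i ([ffun i => (l i).2] i)) = 0.
    rewrite linear_sum -[RHS](raddf0 ev) -T0 raddf_sum.
    by apply: eq_bigr => i _; rewrite evE ffunE.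
  move=> /piE[phi phiE]; exists phi => c cL.
  have [i <-] : exists i, l i = c.
    by have /tnthP[i ->] : c \in in_tuple L by []; exists i.
  have := congr1 (fun v : {ffun _} => v i) phiE; rewrite ffunE => ->.
  by rewrite -(ffun_sum_incl [ffun i => (l i).2]) ffunE.
apply: (finj); rewrite raddf0 raddf_sum /=.
(* Under [f] each right-hand side becomes a left-hand side, whose coefficients are moved into the
   first tensor factor. *)
pose s := [seq (((p.1 : A^c) *: eps i : bihom (int_bimod N') D), (p.2 : N)) | i <- enum 'I_m, p <- (l i).1].
transitivity (tensor_of s).
  rewrite tensor_of_sum big_allpairs_dep /= big_enum /=; apply: eq_bigr => i _.
  rewrite tensor_map_pure /= -LE // pure_tensor_sumr.
  by apply: eq_bigr => p _; rewrite pure_tensor_bal.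
apply: tensor_of_collect => z; apply: hom_ext => y.
(* The total coefficient of [z] sends [y] to the class of [res phi] for this [phi], which is 0 in
   [D]. *)
pose phi x := if x == z then y else 0.
transitivity (pi (res phi)); last by apply/piE; exists phi.
rewrite hom_sumE (ffun_sum_incl (res phi)) linear_sum big_mkcond big_allpairs_dep /=.
rewrite big_enum /=; apply: eq_bigr => i _.
rewrite ffunE -[RHS]/(eps i _) raddf_sum; apply: eq_bigr => p _ /=.
rewrite /phi; case: ifP => // _.
by rewrite scaler0 -[RHS]/(eps i 0) raddf0.
Qed.

End PureLocal.

(** * Finite presentations *)

(** The last clause is the universal property of the cokernel of A^q -> A^p, which spares
    constructing that cokernel. *)
Definition presentation (A : pzRingType) (M : lmodType A) (p q : nat)
    (e : 'I_p -> M) (rho : 'I_q -> 'I_p -> A) : Prop :=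
  [/\ forall x, exists a : 'I_p -> A, x = \sum_k a k *: e k,
      forall l, \sum_k rho l k *: e k = 0
    & forall (N : lmodType A) (v : 'I_p -> N),
        (forall l, \sum_k rho l k *: v k = 0) ->
      exists h : {linear M -> N}, forall k, h (e k) = v k].

Lemma presentation_ext (A : pzRingType) (M N : lmodType A) p q
    (e : 'I_p -> M) (rho : 'I_q -> 'I_p -> A) (h h' : {linear M -> N}) :
  presentation e rho -> (forall k, h (e k) = h' (e k)) -> h =1 h'.
Proof.
move=> [gen _ _] hh' x; have [a ->] := gen x; rewrite !linear_sum.
by apply: eq_bigr => k _; rewrite !linearZ hh'.
Qed.

(* Generators of M lift to a finitely generated projective P_0, which is a
   retract of a free module; the relations are those of P_0 together with the
   generators of the image of P_1. *)
Lemma resolution_presentation (A : pzRingType) (M : lmodType A) :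
    (exists P : proj_resolution M, degreewise_finite P) ->
  exists p q (e : 'I_p -> M) (rho : 'I_q -> 'I_p -> A), presentation e rho.
Proof.
move=> [P Pfin]; have [p [e0 e0gen]] := Pfin 0%N; have [q [e1 e1gen]] := Pfin 1%N.
have pfl : linear (fun a : 'rV[A]_p => \sum_k a 0 k *: e0 k).
  move=> a u v; rewrite scaler_sumr -big_split; apply: eq_bigr => k _ /=.
  by rewrite !mxE scalerDl scalerA.
pose pf : {linear 'rV[A]_p -> P 0%N} := mk_linear pfl.
have pfE a : pf a = \sum_k a 0 k *: e0 k by [].
have pf_surj : surjective pf.
  move=> x; have [a ->] := e0gen x; exists (\row_k a k).
  by rewrite pfE; apply: eq_bigr => k _; rewrite mxE.
have [s sK] := @res_proj _ _ P 0%N _ _ pf idfun pf_surj.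
have s_pf x : \sum_k s x 0 k *: e0 k = x by rewrite -pfE; apply: sK.
(* The first [p] rows are those of the idempotent [s \o pf] minus the identity; they force
   [h (e0 j) = v j] below. The other [q] rows make [h] vanish on the image of P_1. *)
pose rho (l : 'I_(p + q)) (k : 'I_p) : A :=
  match split l with
  | inl j => s (e0 j) 0 k - (j == k)%:R
  | inr j => s (res_d P 0%N (e1 j)) 0 k
  end.
pose e k := res_aug P (e0 k).
have sum_delta (V : lmodType A) (v : 'I_p -> V) j : \sum_k (j == k)%:R *: v k = v j.
  rewrite (bigD1 j) //= eqxx scale1r big1 ?addr0 // => k; rewrite eq_sym.
  by move=> /negPf->; rewrite scale0r.
exists p, (p + q)%N, e, rho; split=> [x|l|N v vrel].
- have [y <-] := @res_aug_surj _ _ P x; exists (fun k => s y 0 k).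
  by rewrite -[in LHS](s_pf y) linear_sum; apply: eq_bigr => k _; rewrite linearZ.
- rewrite /rho; case: (split l) => j.
    under eq_bigr do rewrite scalerBl; rewrite sumrB sum_delta.
    under eq_bigr do rewrite -linearZ; rewrite -linear_sum s_pf.
    by rewrite subrr.
  under eq_bigr do rewrite -linearZ; rewrite -linear_sum s_pf.
  by apply/res_exact0; exists (e1 j).
have hl : linear (fun x : P 0%N => \sum_k s x 0 k *: v k).
  move=> a x y; rewrite scaler_sumr -big_split; apply: eq_bigr => k _ /=.
  by rewrite linearP !mxE scalerDl scalerA.
pose h : {linear P 0%N -> N} := mk_linear hl.
have hE j : h (e0 j) = v j.
  have := vrel (lshift q j); rewrite /rho (unsplitK (inl j)).
  under eq_bigr do rewrite scalerBl; rewrite sumrB sum_delta.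
  exact: subr0_eq.
have [g gE] : exists g : {linear M -> N}, forall x, g (res_aug P x) = h x.
  apply: lin_factor => [|x /res_exact0[y <-]]; first exact: res_aug_surj.
  have [a ->] := e1gen y; rewrite !linear_sum big1 // => j _; rewrite !linearZ.
  have := vrel (rshift p j); rewrite /rho (unsplitK (inr j)) => h0.
  by rewrite [h _]h0; apply: scaler0.
by exists g => k; rewrite gE hE.
Qed.

(** * Purity under Hom_S(C, -) and C (x) - *)

Section LocalPureFunctors.
Variables (S R : pzRingType) (C : bimodType S R).

(** A map out of [C] is a tuple of values at the generators subject to [rho]. So an equation in
    Hom_S(C, N) becomes one equation in [N] per generator, with e_k r expanded in the generators,
    and the relations [rho] join the system for every homomorphism involved. *)
Lemma local_pure_bihom (N' N : lmodType S) (f : {linear N' -> N}) p q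
    (e : 'I_p -> C) (rho : 'I_q -> 'I_p -> S) :
  presentation e rho -> local_pure f -> local_pure (bihom_map C f).
Proof.
move=> pres pf L LE; have [gen rel ex] := pres.
have /choice[a aE] : forall rk : R * 'I_p, exists b : 'I_p -> S,
    actr (e rk.2) rk.1 = \sum_j b j *: e j.
  by move=> rk; apply: gen.
pose c1 (c : seq (R * bihom C N) * bihom C N') (k : 'I_p) : seq (S * N) * N' :=
  ([seq (a (x.1, k) j, (x.2 : lmodHom C N) (e j)) | x <- c.1, j <- enum 'I_p], c.2 (e k)).
pose c2 (h : bihom C N) (l : 'I_q) : seq (S * N) * N' :=
  ([seq (rho l k, h (e k)) | k <- enum 'I_p], 0).
pose hs := [seq x.2 | x <- flatten [seq c.1 | c <- L]].
have [|phi phiE] := pf ([seq c1 c k | c <- L, k <- enum 'I_p] ++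
                        [seq c2 h l | h <- hs, l <- enum 'I_q]).
  move=> c; rewrite mem_cat => /orP[] /allpairsP[[/= x k] [xL _ ->]] /=.
    rewrite big_allpairs_dep /=; have := LE _ xL.
    move=> /(congr1 (fun h : lmodHom C N => h (e k))); rewrite hom_sumE => eqk.
    apply: etrans eqk; apply: eq_bigr => y _; rewrite big_enum /= -[RHS]/((y.2 : lmodHom C N) (actr (e k) y.1)).
    rewrite (aE (y.1, k)) linear_sum; apply: eq_bigr => j _; rewrite linearZ //.
  rewrite big_map big_enum /= linear0 -[RHS](linear0 x) -(rel k) linear_sum.
  by apply: eq_bigr => j _; rewrite linearZ.
(* When the values of [phi] at the [h (e k)] violate [rho], 0 is a harmless default, as they satisfy
   [rho] for all [h] in [hs]. *)
have /choice[Phi PhiE] : forall h : bihom C N, exists g : bihom C N',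
    (forall l, \sum_k rho l k *: phi (h (e k)) = 0) ->
    forall k, g (e k) = phi (h (e k)).
  move=> h; have [/ex[g gE]|nr] := pselect (forall l, \sum_k rho l k *: phi (h (e k)) = 0).
    by exists g.
  by exists 0.
have {}PhiE h : h \in hs -> forall k, Phi h (e k) = phi (h (e k)).
  move=> hhs; apply: PhiE => l.
  have /phiE /= : c2 h l \in [seq c1 c k | c <- L, k <- enum 'I_p] ++
                        [seq c2 h l | h <- hs, l <- enum 'I_q].
    by rewrite mem_cat orbC allpairs_f // mem_enum.
  by rewrite big_map big_enum.
exists Phi => c cL; apply: hom_ext; apply: (presentation_ext pres) => k.
have /phiE /= <- : c1 c k \in [seq c1 c k | c <- L, k <- enum 'I_p] ++
                        [seq c2 h l | h <- hs, l <- enum 'I_q].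
  by rewrite mem_cat allpairs_f // mem_enum.
rewrite hom_sumE big_allpairs_dep /= big_seq [RHS]big_seq; apply: eq_bigr => x xc.
rewrite big_enum /= -[LHS]/(Phi x.2 (actr (e k) x.1)) (aE (x.1, k)) linear_sum.
apply: eq_bigr => j _; rewrite linearZ PhiE //; apply: map_f.
by apply/flattenP; exists c.1 => //; apply: map_f.
Qed.

Lemma bitensor_sum_of (M F : lmodType R) (l : bitensor C M -> seq (rightmod C * F))
    (c : seq (S * bitensor C M)) :
  \sum_(x <- c) x.1 *: (tensor_of (l x.2) : bitensor C F) =
  tensor_of [seq (lmul x.1 y.1, y.2) | x <- c, y <- l x.2].
Proof.
rewrite tensor_of_sum big_allpairs_dep; apply: eq_bigr => x _.
by rewrite bitensor_scale_of tensor_of_sum big_map.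
Qed.

(** Each equation is an equality of tensors, hence a consequence of finitely many relations in [M].
    A local retraction that preserves them all and undoes [f] on the right-hand sides is applied to
    second components. *)
Lemma local_pure_bitensor (M' M : lmodType R) (f : {linear M' -> M}) :
  local_pure f -> local_pure (bitensor_map C f).
Proof.
move=> pf L LE.
pose lhs (c : seq (S * bitensor C M) * bitensor C M') : seq (rightmod C * M) :=
  [seq (lmul x.1 y.1, y.2) | x <- c.1, y <- tensor_repr x.2].
pose rhs (c : seq (S * bitensor C M) * bitensor C M') : seq (rightmod C * M) :=
  [seq (y.1, f y.2) | y <- tensor_repr c.2].
pose good c (E : seq (seq (R * M))) := c \in L ->
    (forall e, e \in E -> \sum_(p <- e) p.1 *: p.2 = 0) /\
    forall (G : lmodType R) (phi : M -> G),
      (forall e, e \in E -> \sum_(p <- e) p.1 *: phi p.2 = 0) ->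
    tensor_rel [seq (p.1, phi p.2) | p <- lhs c] [seq (p.1, phi p.2) | p <- rhs c].
have /choice[E goodE] : forall c, exists E, good c E.
  move=> c; have [cL|ncL] := boolP (c \in L); last first.
    by exists [::]; rewrite /good (negPf ncL).
  have /tensor_ofP/tensor_rel_local[E EE] : tensor_of (lhs c) = tensor_of (rhs c).
    have := LE c cL; rewrite bitensor_mapE -[c.2]tensor_reprK tensor_map_of => <-.
    rewrite -bitensor_sum_of; apply: eq_bigr => x _.
    by rewrite tensor_reprK.
  by exists E.
pose Es := flatten [seq E c | c <- L].
have EsE c e : c \in L -> e \in E c -> e \in Es.
  by move=> cL eE; apply/flattenP; exists (E c) => //; apply: map_f.
pose Y := flatten [seq [seq y.2 | y <- tensor_repr c.2] | c <- L].
have [|phi [phiE phiY]] := local_pure_retract pf (E := Es) Y.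
  by move=> e /flattenP[_ /mapP[c cL ->]]; have [+ _] := goodE c cL; apply.
pose lphi (t : bitensor C M) : seq (rightmod C * M') :=
  [seq (p.1, phi p.2) | p <- tensor_repr t].
(* [phi] is only a function and need not respect equality of tensors, so it acts on chosen
   representatives, the same in which [lhs] is written. *)
exists (fun t => tensor_of (lphi t)) => c cL.
have [_ /(_ _ phi) goodc] := goodE c cL.
have /goodc/tensor_ofP : forall e, e \in E c -> \sum_(p <- e) p.1 *: phi p.2 = 0.
  by move=> e /(EsE c e cL)/phiE.
rewrite bitensor_sum_of -map_comp => ceq.
rewrite -[RHS]tensor_reprK; transitivity (tensor_of [seq (p.1, phi p.2) | p <- lhs c]).
  congr (tensor_of _); rewrite /lhs map_flatten -map_comp; congr flatten.
  by apply: eq_map => x /=; rewrite -!map_comp; apply: eq_map.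
rewrite ceq; congr (tensor_of _); rewrite -[RHS]map_id.
apply/eq_in_map => -[m x] mx /=; rewrite phiY //; apply/flattenP.
exists [seq y.2 | y <- tensor_repr c.2]; first exact: (map_f _ cL).
by apply/mapP; exists (m, x).
Qed.

End LocalPureFunctors.

Lemma inj_surj_bij (T U : Type) (f : T -> U) :
  injective f -> surjective f -> bijective f.
Proof.
move=> f_inj /choice[g gK]; exists g => // x.
exact/f_inj/gK.
Qed.

Section TensorFfun.
Variables (A : pzRingType) (M : lmodType A^c) (F : lmodType A) (I : finType).

(** The identity of M^I is the sum over I of projection followed by inclusion, and this survives
    tensoring. *)
Lemma tensor_ffun_eq0 (w : tensor {ffun I -> M} F) :
  (forall i, tensor_map (ffun_proj M i) (@idfun F) w = 0) -> w = 0.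
Proof.
move=> w0.
have -> : w = \sum_i tensor_map (ffun_incl M i) (@idfun F)
                       (tensor_map (ffun_proj M i) (@idfun F) w).
  move: w {w0}; apply: tensor_elim => [|t u IHt IHu|c x].
  - by rewrite big1 // => i _; rewrite !raddf0.
  - under eq_bigr do rewrite !raddfD.
    by rewrite big_split /= -IHt -IHu.
  under eq_bigr do rewrite !tensor_map_pure.
  by rewrite -pure_tensor_suml -ffun_sum_incl.
by rewrite big1 // => i _; rewrite w0 raddf0.
Qed.

Lemma tensor_ffun_ex (t : I -> tensor M F) :
  exists w, forall i, tensor_map (ffun_proj M i) (@idfun F) w = t i.
Proof.
exists (\sum_i tensor_map (ffun_incl M i) (@idfun F) (t i)) => j.
rewrite raddf_sum (bigD1 j) //= big1 ?addr0 => [|i /negPf ij].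
  rewrite tensor_map_comp -[RHS]tensor_map_id; apply: eq_tensor_map => // x /=.
  by rewrite [LHS]ffun_proj_incl eqxx.
elim/tensor_elim: (t i) => [|u v IHu IHv|m x]; first by rewrite !raddf0.
  by rewrite !raddfD /= IHu IHv addr0.
by rewrite !tensor_map_pure ffun_proj_incl eq_sym ij pure_tensor0l.
Qed.

End TensorFfun.

(** * Baer's criterion *)

Section Baer.
Variables (A : pzRingType) (I : lmodType A).

Local Open Scope classical_set_scope.

(** Zorn's lemma on graphs of partial extensions. [h] is a function on all of [A] that is
    constrained only on [J]. *)
Lemma baer_criterion :
    (forall (J : A -> Prop) (h : A -> I), left_ideal J ->
      (forall x y, J x -> J y -> h (x + y) = h x + h y) ->
      (forall a x, J x -> h (a * x) = a *: h x) ->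
      exists z, forall x, J x -> h x = x *: z) ->
  injective_module I.
Proof.
move=> baer M N i f i_inj.
(* [G] is the graph of a linear map on a submodule of [N] that extends [f] along [i]. *)
pose good (G : set (N * I)) := [/\ submodule (G : (N * I)%type -> Prop),
  forall z, G (0, z) -> z = 0 & forall m, G (i m, f m)].
have good_uniq G n z z' : good G -> G (n, z) -> G (n, z') -> z = z'.
  move=> [[G0 GD GZ] Gf _] Gz Gz'; apply/subr0_eq/Gf.
  have -> : (0, z - z') = (n, z) + (-1) *: (n, z') :> (N * I)%type.
    by congr (_, _) => /=; rewrite scaleN1r ?subrr.
  by apply: (GD) => //; apply: (GZ).
(* [P] admits the empty set, as it is the union of the empty chain. *)
pose P : set (set (N * I)) := [set G | (exists x, G x) -> good G].
have [|G [PG Gmax]] := @Zorn_bigcup _ P.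
  move=> F FP Ftot [x0 [X FX Xx0]].
  have [[X0 _ _] _ Xb] := FP X FX (ex_intro _ x0 Xx0).
  have chain Y Z x y : F Y -> F Z -> Y x -> Z y -> exists W, [/\ F W, good W, W x & W y].
    move=> FY FZ Yx Zy; have [YZ|ZY] := Ftot _ _ FY FZ.
      by exists Z; split=> //; [apply: FP => //; exists y | apply: YZ].
    by exists Y; split=> //; [apply: FP => //; exists x | apply: ZY].
  split; first split.
  - by exists X.
  - move=> x y [Y FY Yx] [Z FZ Zy].
    have [W [FW [[_ WD _] _ _] Wx Wy]] := chain _ _ _ _ FY FZ Yx Zy.
    by exists W => //; apply: WD.
  - move=> a x [Y FY Yx]; have [W [FW [[_ _ WZ] _ _] Wx _]] := chain _ _ _ _ FY FY Yx Yx.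
    by exists W => //; apply: WZ.
  - move=> z [Y FY Yz]; have [W [FW [_ Wf _] Wz _]] := chain _ _ _ _ FY FY Yz Yz.
    exact: Wf.
  - by move=> m; exists X.
have maxG B : good B -> G `<=` B -> B `<=` G.
  move=> gB GB; apply: contrapT => nBG.
  by apply: (Gmax B) => // _.
(* A maximal [G] is nonempty, since otherwise the pairs [(i m, f m)] would form a larger element. *)
have gG : good G.
  have [/PG //|nG] := pselect (exists x, G x); exfalso; apply: (nG).
  exists (0, 0); apply: (maxG [set x | exists m, (i m, f m) = x]).
  - split; first split.
    + by exists 0; rewrite !linear0.
    + by move=> _ _ [m <-] [m' <-]; exists (m + m'); rewrite !linearD.
    + by move=> a _ [m <-]; exists (a *: m); rewrite !linearZ.
    + move=> z [m [im <-]]; have -> : m = 0 by apply: i_inj; rewrite im linear0.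
      exact: linear0.
    + by move=> m; exists m.
  - by move=> x Gx; case: nG; exists x.
  - by exists 0; rewrite !linear0.
have [[G0 GD GZ] Gf Gb] := gG.
have /choice[g gE] : forall n, exists z, G (n, z).
  (* [J] consists of the [a] with [a *: n] in the domain of [G]. The criterion makes [G] on these
     multiples the multiplication by some [z0], so [(n, z0)] can be adjoined, and by maximality it
     is in [G] already. *)
  move=> n; pose J a := exists z, G (a *: n, z).
  have /choice[h hE] : forall a, exists z, J a -> G (a *: n, z).
    by move=> a; have [[z Gz]|nJ] := pselect (J a); [exists z | exists 0].
  have [| | |z0 z0E] := baer J h.
  - split=> [|x y [z Gz] [z' Gz']|a x [z Gz]].
    + by exists 0; rewrite scale0r.
    + by exists (z + z'); rewrite scalerDl; apply: (GD _ _ Gz Gz').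
    + by exists (a *: z); rewrite -scalerA; apply: (GZ a _ Gz).
  - move=> x y Jx Jy; apply: (good_uniq G ((x + y) *: n)) => //.
      apply: (hE); have [[z Gz] [z' Gz']] := (Jx, Jy).
      by exists (z + z'); rewrite scalerDl; apply: (GD _ _ Gz Gz').
    by rewrite scalerDl; apply: (GD _ _ (hE _ Jx) (hE _ Jy)).
  - move=> a x Jx; apply: (good_uniq G ((a * x) *: n)) => //.
      apply: (hE); have [z Gz] := Jx.
      by exists (a *: z); rewrite -scalerA; apply: (GZ a _ Gz).
    by rewrite -scalerA; apply: (GZ a _ (hE _ Jx)).
  pose B : set (N * I) := [set x | exists y a, G y /\ x = y + a *: (n, z0)].
  have GB : G `<=` B by move=> x Gx; exists x, 0; rewrite scale0r addr0.
  exists z0; apply: (maxG B) => //; last by exists 0, 1; rewrite scale1r add0r.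
  split; first split.
  - exact: GB.
  - move=> _ _ [x [a [Gx ->]]] [y [b [Gy ->]]]; exists (x + y), (a + b).
    by rewrite scalerDl addrACA; split=> //; apply: GD.
  - move=> b _ [x [a [Gx ->]]]; exists (b *: x), (b * a).
    by rewrite scalerDr scalerA; split=> //; apply: GZ.
  - move=> w [[x z] [a [Gxz [/esym xan ->]]]]; move: Gxz.
    have -> : x = - a *: n by apply/eqP; rewrite scaleNr -addr_eq0 xan.
    move=> Gz; have JNa : J (- a) by exists z.
    rewrite (good_uniq _ _ _ _ gG Gz (hE _ JNa)) z0E //.
    by rewrite scaleNr addNr.
  - by move=> m; apply/GB/Gb.
have gl : linear g.
  move=> a x y; apply: (good_uniq G (a *: x + y)) => //.
  exact: (GD _ _ (GZ a _ (gE x)) (gE y)).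
by exists (mk_linear gl) => m; apply: (good_uniq G (i m)).
Qed.

End Baer.

(** For [h] on an ideal [J], the composite of [h] with [f] extends to [A], hence is multiplication
    by [g 1]. As [J] is finitely generated, this is a finite system e_j z = f (h e_j) with a
    solution in [N]; purity solves it in [N']. *)
Lemma pure_injective (A : pzRingType) (N' N : lmodType A) (f : {linear N' -> N}) :
    left_noetherian A -> local_pure f -> injective_module N ->
  injective_module N'.
Proof.
move=> noeth pf injN; apply: baer_criterion => J h idJ hD hZ.
have [n [e [Je Jgen]]] := noeth J idJ.
have subJ : submodule (J : A^o -> Prop) by case: idJ.
have [K [io [io_inj ioE]]] := submodule_ex subJ.
have Jio k : J (io k) by apply/ioE; exists k.
have hl : linear (h \o io : K -> N').
  move=> a x y /=; rewrite linearP hD ?hZ //.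
  by case: idJ => _ _ JZ; apply: JZ.
have [g gE] := injN _ _ io (f \o mk_linear hl : {linear K -> N}) io_inj.
have {}gE x : J x -> x *: g 1 = f (h x).
  move=> /ioE[k <-]; rewrite -[RHS]gE /= -linearZ; congr (g _).
  exact: mulr1.
have [|phi phiE] := pf [seq ([:: (e j, g 1)], h (e j)) | j <- enum 'I_n].
  by move=> _ /mapP[j _ ->]; rewrite big_seq1 /= gE.
exists (phi (g 1)) => x /Jgen[a ->].
have hsum (r : seq 'I_n) : h (\sum_(j <- r) a j * e j) = \sum_(j <- r) a j *: h (e j).
  have [J0 JD JM] := idJ.
  elim: r => [|j r IHr].
    by rewrite !big_nil -(mul0r 0) hZ // scale0r.
  rewrite !big_cons hD ?IHr ?hZ //; first exact: JM.
  by elim/big_ind: _ => // k _; apply: JM.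
rewrite hsum scaler_suml; apply: eq_bigr => j _; rewrite -scalerA; congr (_ *: _).
have /phiE : ([:: (e j, g 1)], h (e j)) \in [seq ([:: (e j, g 1)], h (e j)) | j <- enum 'I_n].
  by apply: (map_f (fun j => ([:: (e j, g 1)], h (e j)))); rewrite mem_enum.
by rewrite big_seq1 => /= ->.
Qed.

(** * The adjunction between C (x) - and Hom_S(C, -) *)

Section UnitCounit.
Variables (S R : pzRingType) (C : bimodType S R).

Section Unit.
Variable F : lmodType R.

Let unit_hom_linear x : linear (fun c : C => pure_tensor (c : rightmod C) x : bitensor C F).
Proof.
move=> s c d; rewrite [LHS]pure_tensorDl; congr (_ + _).
by rewrite [RHS]bitensor_scale_pure.
Qed.

Let unit_linear : linear (fun x => mk_linear (unit_hom_linear x) : bihom C (bitensor C F)).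
Proof.
move=> r x y; apply: hom_ext => c /=; rewrite [LHS]pure_tensorDr; congr (_ + _).
by rewrite -pure_tensor_bal.
Qed.

Definition unit_map : {linear F -> bihom C (bitensor C F)} := mk_linear unit_linear.

Lemma unit_mapE x c : unit_map x c = pure_tensor (c : rightmod C) x.
Proof. by []. Qed.

End Unit.

Lemma counit_ex (N : lmodType S) :
  exists nu : {linear bitensor C (bihom C N) -> N},
    forall (c : rightmod C) (h : bihom C N), nu (pure_tensor c h) = h c.
Proof.
have [nu nuE] : exists nu : {additive tensor (rightmod C) (bihom C N) -> N},
    forall (c : rightmod C) (h : bihom C N), nu (pure_tensor c h) = h c.
  by apply: tensor_lift => [h c d|c h h'|c r h] //; apply: (raddfB h).
have nul : linear (nu : bitensor C (bihom C N) -> N).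
  move=> s t u; rewrite [LHS]raddfD; congr (_ + _).
  elim/tensor_elim: t => [|t t' IHt IHt'|c h].
  - by rewrite [s *: _]scaler0 raddf0 scaler0.
  - transitivity (nu (s *: (t : bitensor C _)) + nu (s *: (t' : bitensor C _))).
      by rewrite -raddfD; congr (nu _); exact: (@scalerDr S (bitensor C (bihom C N)) s t t').
    by rewrite IHt IHt' -scalerDr [in RHS]raddfD.
  rewrite bitensor_scale_pure !nuE; exact: (linearZZ (h : {linear C -> N})).
by exists (mk_linear nul).
Qed.

Definition counit_map N := projT1 (cid (counit_ex N)).

Lemma counit_mapE N (c : rightmod C) (h : bihom C N) :
  counit_map N (pure_tensor c h) = h c.
Proof. exact: (projT2 (cid (counit_ex N))). Qed.

Lemma counit_natural (N N' : lmodType S) (f : {linear N -> N'}) t :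
  counit_map N' (bitensor_map C (bihom_map C f) t) = f (counit_map N t).
Proof.
elim/tensor_elim: t => [|t u IHt IHu|c h].
- by rewrite !raddf0.
- by rewrite !raddfD /= IHt IHu.
by rewrite bitensor_mapE tensor_map_pure !counit_mapE.
Qed.

Lemma unit_natural (F F' : lmodType R) (f : {linear F -> F'}) x :
  unit_map F' (f x) = bihom_map C (bitensor_map C f) (unit_map F x).
Proof.
by apply: hom_ext => c; rewrite [RHS]tensor_map_pure.
Qed.

(** Triangle identity; where the counit is injective, it makes C (x) mu surjective. *)
Lemma counit_bitensor_unit (F : lmodType R) t :
  counit_map (bitensor C F) (bitensor_map C (unit_map F) t) = t.
Proof.
elim/tensor_elim: t => [|t u IHt IHu|c h].
- by rewrite !raddf0.
- by rewrite !raddfD /= IHt IHu.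
by rewrite bitensor_mapE tensor_map_pure counit_mapE.
Qed.

(** The other triangle identity; it recovers [h] from its image under the unit. *)
Lemma bihom_counit_unit (N : lmodType S) h :
  bihom_map C (counit_map N) (unit_map (bihom C N) h) = h.
Proof. by apply: hom_ext => c; rewrite bihom_mapE unit_mapE counit_mapE. Qed.

(* Since F is flat, tensoring 0 -> R -> C^p -> C^q, which is Hom_S(-, C) applied
   to a presentation of C, with F stays exact. *)
Lemma unit_bijective (F : lmodType R) p q (e : 'I_p -> C) (rho : 'I_q -> 'I_p -> S) :
    presentation e rho -> bijective (rhomothety C) -> flat F ->
  bijective (unit_map F).
Proof.
move=> pres [rinv rinvK rinvK'] flatF; have [gen rel ex] := pres.
pose Cr := rightmod C.
have al : linear (fun r : (R^c)^o => [ffun k => (actr (e k) (r : R) : Cr)]).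
  move=> a r r'; apply/ffunP => k; rewrite !ffunE actrDr; congr (_ + _).
  by rewrite -[RHS]/(actr (actr _ _) _) actrA.
pose alpha : {linear (R^c)^o -> {ffun 'I_p -> Cr}} := mk_linear al.
have bl : linear (fun c : {ffun 'I_p -> Cr} => [ffun l => \sum_k lmul (rho l k) (c k)]).
  move=> a c c'; apply/ffunP => l; rewrite !ffunE scaler_sumr -big_split.
  by apply: eq_bigr => k _; rewrite !ffunE linearP.
pose beta : {linear {ffun 'I_p -> Cr} -> {ffun 'I_q -> Cr}} := mk_linear bl.
have alphaE r k : alpha r k = actr (e k) r by rewrite ffunE.
have betaE c l : beta c l = \sum_k rho l k *: (c k : C) by rewrite ffunE.
have alpha_inj : injective alpha.
  move=> r r' arr'; apply: (can_inj rinvK).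
  apply: hom_ext; apply: (presentation_ext pres) => k.
  by rewrite [LHS]/= /rmul -alphaE arr' alphaE.
have alpha_beta : exact_at alpha beta.
  move=> c; split=> [bc|[r <-]].
    (* A tuple killed by [beta] satisfies the relations, so it comes from an endomorphism of [C],
       which is right multiplication by an element of [R]. *)
    have [l|h hE] := ex C (fun k => c k).
      by rewrite -betaE bc ffunE.
    exists (rinv h); apply/ffunP => k; rewrite alphaE -hE.
    by rewrite -[in RHS](rinvK' h).
  apply/ffunP => l; rewrite betaE ffunE.
  transitivity (@rmul S R C r (\sum_k rho l k *: e k)); last by rewrite rel raddf0.
  rewrite linear_sum; apply: eq_bigr => k _.
  by rewrite alphaE linearZ.
have projbeta l (w : tensor {ffun 'I_p -> Cr} F) :
    tensor_map (ffun_proj Cr l) (@idfun F) (tensor_map beta (@idfun F) w) =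
    \sum_k rho l k *: (tensor_map (ffun_proj Cr k) (@idfun F) w : bitensor C F).
  elim/tensor_elim: w => [|w w' IHw IHw'|c x].
  - by rewrite !raddf0 big1 // => k _; rewrite raddf0 [LHS]scaler0.
  - rewrite !raddfD /= IHw IHw' -big_split; apply: eq_bigr => k _ /=.
    by rewrite raddfD [RHS]scalerDr.
  rewrite !tensor_map_pure [ffun_proj _ _ _]betaE pure_tensor_suml.
  by apply: eq_bigr => k _; rewrite tensor_map_pure bitensor_scale_pure.
have pure1 (u : tensor (R^c)^o F) : exists x, u = pure_tensor (1 : (R^c)^o) x.
  elim/tensor_elim: u => [|u u' [x ->] [x' ->]|r x].
  - by exists 0; rewrite pure_tensor0r.
  - by exists (x + x'); rewrite pure_tensorDr.
  by exists ((r : R) *: x); rewrite -pure_tensor_bal; congr pure_tensor; rewrite [RHS]mulr1.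
have projalpha x k : tensor_map (ffun_proj Cr k) (@idfun F)
    (tensor_map alpha (@idfun F) (pure_tensor (1 : (R^c)^o) x)) = unit_map F x (e k).
  by rewrite !tensor_map_pure [ffun_proj _ _ _]alphaE actr1.
apply: inj_surj_bij.
  apply: linear_inj => x x0.
  have [Phi PhiE] : exists Phi : {additive tensor (R^c)^o F -> F},
      forall (r : (R^c)^o) x, Phi (pure_tensor r x) = (r : R) *: x.
    apply: tensor_lift => [y r r'|r y y'|r a y].
    - exact: (scalerBl (r : R)).
    - exact: scalerBr.
    by rewrite scalerA.
  rewrite -[x](@scale1r R) -(PhiE 1).
  suff -> : pure_tensor (1 : (R^c)^o) x = 0 by rewrite raddf0.
  apply: (flat_inj flatF alpha_inj); rewrite [RHS]raddf0.
  by apply: tensor_ffun_eq0 => k; rewrite projalpha x0.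
(* The values of [h] at the generators form an element of C^p (x) F that [beta] kills, as [h]
   respects the relations. By exactness it comes from R (x) F, that is, from [F]. *)
move=> h; have [w wE] := tensor_ffun_ex (fun k => h (e k) : tensor Cr F).
have /(flat_exact flatF alpha_beta)[u uw] : tensor_map beta (@idfun F) w = 0.
  apply: tensor_ffun_eq0 => l; rewrite projbeta.
  transitivity (h (\sum_k rho l k *: e k)); last by rewrite rel raddf0.
  by rewrite linear_sum; apply: eq_bigr => k _; rewrite linearZ wE.
have [x uE] := pure1 u; exists x; apply: hom_ext; apply: (presentation_ext pres) => k.
by rewrite -projalpha -uE uw wE.
Qed.

(* For I injective, Hom_S(-, I) sends 0 -> S -> C^p -> C^q to a presentation of
   I by sums of copies of Hom_S(C, I). *)
Lemma counit_bijective (I : lmodType S) p q (e : 'I_p -> rightmod C)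
    (rho : 'I_q -> 'I_p -> R^c) :
    presentation e rho -> bijective (lhomothety C) -> injective_module I ->
  bijective (counit_map I).
Proof.
move=> pres [linv linvK linvK'] injI; have [gen rel ex] := pres.
have al : linear (fun s : S^o => [ffun k => (s : S) *: (e k : C)]).
  by move=> a s s'; apply/ffunP => k; rewrite !ffunE scalerDl scalerA.
pose alpha : {linear S^o -> {ffun 'I_p -> C}} := mk_linear al.
have bl : linear (fun c : {ffun 'I_p -> C} => [ffun l => \sum_k rmul (rho l k : R) (c k)]).
  move=> a c c'; apply/ffunP => l; rewrite !ffunE scaler_sumr -big_split.
  by apply: eq_bigr => k _; rewrite !ffunE linearP.
pose beta : {linear {ffun 'I_p -> C} -> {ffun 'I_q -> C}} := mk_linear bl.
have alphaE (s : S) k : alpha s k = s *: (e k : C) by rewrite ffunE.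
have betaE c l : beta c l = \sum_k rmul (rho l k : R) (c k) by rewrite ffunE.
apply: inj_surj_bij.
  apply: linear_inj => t t0.
  have [h tE] : exists h : 'I_p -> bihom C I, t = \sum_k pure_tensor (e k) (h k).
    elim/tensor_elim: t {t0} => [|u v [h ->] [h' ->]|c h].
    - by exists (fun=> 0); rewrite big1 // => k _; rewrite pure_tensor0r.
    - exists (fun k => h k + h' k); rewrite -[LHS]big_split.
      by apply: eq_bigr => k _; rewrite pure_tensorDr.
    have [a ->] := gen c; exists (fun k => (a k : R) *: h).
    by rewrite pure_tensor_suml; apply: eq_bigr => k _; rewrite pure_tensor_bal.
  have hl : linear (fun c : {ffun 'I_p -> C} => \sum_k h k (c k)).
    move=> a c c'; rewrite scaler_sumr -big_split; apply: eq_bigr => k _.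
    by rewrite !ffunE linearP.
  have he : \sum_k h k (e k) = 0.
    apply: etrans t0; rewrite tE linear_sum; apply: eq_bigr => k _.
    by rewrite counit_mapE.
  (* An element of the kernel of [beta] is a tuple (s e_k), which the functional sends to s times
     the sum of the h_k e_k, that is, to 0. So the functional extends along [beta] to C^q. *)
  have [c bc|g gE] := injective_extend (b := beta) (h := mk_linear hl) injI.
    have [l|s sE] := ex (rightmod C) (fun k => c k).
      by apply: etrans (_ : beta c l = 0); rewrite ?betaE // -betaE bc ffunE.
    transitivity (linv s *: \sum_k h k (e k)); last by rewrite he scaler0.
    rewrite -[LHS]/(\sum_k h k (c k)) scaler_sumr; apply: eq_bigr => k _; rewrite -sE -linearZ; congr (h k _).
    by rewrite -[in LHS](linvK' s).
  pose gl l : bihom C I := g \o ffun_incl C l.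
  (* In terms of the components of [g], [h k] has coefficients [rho l k]; balancing moves them to
     the left factor, where the relations kill them. *)
  have hE k : h k = \sum_l (rho l k : R) *: gl l.
    apply: hom_ext => c; rewrite hom_sumE.
    transitivity (g (beta (ffun_incl C k c))).
      rewrite gE -[RHS]/(\sum_j h j (ffun_incl C k c j)) (bigD1 k) //=.
      rewrite ffun_inclE eqxx mulr1n big1 ?addr0 // => j /negPf jk.
      by rewrite ffun_inclE jk mulr0n raddf0.
    rewrite [beta _]ffun_sum_incl linear_sum; apply: eq_bigr => l _.
    rewrite betaE; rewrite -[RHS]/(g (ffun_incl C l (rmul _ c))); congr (g (ffun_incl C l _)).
    rewrite (bigD1 k) //= ffun_inclE eqxx mulr1n big1 ?addr0 // => j /negPf jk.
    by rewrite ffun_inclE jk mulr0n raddf0.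
  rewrite tE; under eq_bigr do rewrite hE pure_tensor_sumr.
  rewrite exchange_big /= big1 // => l _.
  under eq_bigr do rewrite -pure_tensor_bal.
  by rewrite -pure_tensor_suml rel pure_tensor0l.
move=> x.
(* This map is extended along the injection S -> C^p, and the components of the extension make up a
   preimage of [x]. *)
have xl : linear (fun s : S^o => (s : S) *: x).
  by move=> a s s'; rewrite scalerDl scalerA.
have [s as0|g gE] := injective_extend (b := alpha) (h := mk_linear xl) injI.
  suff -> : s = 0 by exact: (@scale0r S I x).
  apply: (can_inj linvK); apply: hom_ext; apply: (presentation_ext pres) => k.
  by rewrite -[LHS]alphaE as0 ffunE [RHS](@scale0r S C).
exists (\sum_k pure_tensor (e k) (g \o ffun_incl C k : bihom C I)).
rewrite linear_sum -[RHS](scale1r x) -[RHS](gE 1) [alpha 1]ffun_sum_incl linear_sum.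
apply: eq_bigr => k _; rewrite counit_mapE alphaE scale1r //.
Qed.

(** Faithfulness of Hom is carried over to tensor products by duality. Let D be the cokernel of [u]
    as an abelian group and K the right module of additive maps M' -> D vanishing on the image of
    [u]. A map C -> K is a balanced pairing on C and M' that vanishes on the image of C (x) u, so it
    is 0. Hence K = 0, yet K contains the projection M' -> D. *)
Lemma bitensor_faithful (M M' : lmodType R) (u : {linear M -> M'}) :
    (forall Q : lmodType R^c,
      (forall f : lmodHom (rightmod C) Q, f = 0) -> forall x : Q, x = 0) ->
    surjective (bitensor_map C u) ->
  surjective u.
Proof.
move=> faith us.
have [D [pi [_ piE]]] : exists (D : lmodType int) (pi : {linear zmodule M' -> D}),
    surjective pi /\ forall y : M', pi y = 0 <-> exists x, u x = y.
  apply: (@quotient_ex int (zmodule M') (fun y : M' => exists x, u x = y)).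
  apply: subgroup_submodule.
  - by exists 0; rewrite linear0.
  - by move=> _ _ [x <-] [y <-]; exists (x + y); rewrite linearD.
  - by move=> _ [x <-]; exists (- x); rewrite linearN.
pose B := bihom (int_bimod M') D.
pose H (b : B) := forall x, b (u x) = 0.
have subH : submodule H.
  split=> [x|b b' bH b'H x|a b bH x] //.
    by rewrite -[LHS]/(b (u x) + b' (u x)) bH b'H addr0.
  by rewrite -[LHS]/(b ((a : R) *: u x)) -linearZ bH.
have [K [io [io_inj ioE]]] := submodule_ex subH.
have K0 : forall k : K, k = 0.
  apply: faith => f; apply: hom_ext => c; apply: io_inj; apply: hom_ext => y.
  have [Phi PhiE] : exists Phi : {additive tensor (rightmod C) M' -> D},
      forall c y, Phi (pure_tensor c y) = (io (f c) : B) y.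
    apply: tensor_lift => [z c1 c2|d|d a z].
    - by rewrite !linearB.
    - exact: (raddfB (io (f d) : B)).
    by rewrite !linearZ.
  rewrite -[LHS](PhiE c y) [RHS]/= linear0.
  have [t <-] := us (pure_tensor c y); rewrite bitensor_mapE.
  elim/tensor_elim: t => [|t t' IHt IHt'|d x].
  - by rewrite !raddf0.
  - by rewrite !raddfD /= IHt IHt' addr0.
  rewrite tensor_map_pure PhiE.
  by have /ioE : exists k, io k = io (f d) by exists (f d).
move=> y; apply/piE.
have /ioE[k kE] : H (pi : B) by move=> x; apply/piE; exists x.
by rewrite -[pi]kE (K0 k) linear0.
Qed.

End UnitCounit.

(** * Isomorphisms, split sequences and flatness along pure sequences *)

Lemma bij_linear_inverse (A : pzRingType) (M N : lmodType A) (f : {linear M -> N}) :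
  bijective f -> exists g : {linear N -> M}, cancel f g /\ cancel g f.
Proof.
by move=> [g fK gK]; exists (mk_linear (can2_linear fK gK : linear g)).
Qed.

Lemma lmod_iso_sym (A : pzRingType) (M N : lmodType A) :
  lmod_iso M N -> lmod_iso N M.
Proof.
by move=> [f /bij_linear_inverse[g [fK gK]]]; exists g, f.
Qed.

Lemma injective_iso (A : pzRingType) (I J : lmodType A) :
  lmod_iso I J -> injective_module I -> injective_module J.
Proof.
move=> [f /bij_linear_inverse[g [fK gK]]] injI M N i h i_inj.
have [k kE] := injI _ _ i (g \o h : {linear M -> I}) i_inj.
exists (f \o k : {linear N -> J}) => x /=.
by rewrite -[k (i x)]/((k \o i) x) kE /= gK.
Qed.

Section SplitInjective.
Variables (A : pzRingType) (L M N : lmodType A).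
Variables (f : {linear L -> M}) (g : {linear M -> N}).
Hypotheses (fg : short_exact f g) (injL : injective_module L).

(** For a retraction [r] of [f], the map x - f (r x) kills the image of [f], so it descends to a
    section of [g]. *)
Lemma injective_split : exists s : {linear N -> M}, forall x, g (s x) = x.
Proof.
have [fi fge gs] := fg.
have [r rf] := injL (i := f) idfun fi.
have hl : linear (fun x => x - f (r x)).
  by move=> a x y; rewrite (linearP r) (linearP f) scalerBr opprD addrACA.
have [|s sE] := lin_factor (p := g) (h := mk_linear hl) gs.
  move=> _ /fge[l <-]; rewrite -[LHS]/(f l - f (r (f l))).
  by rewrite -[r (f l)]/((r \o f) l) rf subrr.
exists s => x; have [y <-] := gs x; rewrite sE -[in LHS]/(_ - _) linearB.
by have /fge -> : exists l, f l = f (r y); [exists (r y) | rewrite subr0].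
Qed.

Lemma injective_quotient : injective_module M -> injective_module N.
Proof.
have [s sK] := injective_split => injM P Q i h i_inj.
have [k kE] := injM _ _ i (s \o h : {linear P -> M}) i_inj.
exists (g \o k : {linear Q -> N}) => x /=.
by rewrite -[k (i x)]/((k \o i) x) kE /= sK.
Qed.

End SplitInjective.

Section FlatPure.
Variables (A : pzRingType) (F' F F'' : lmodType A).
Variables (f : {linear F' -> F}) (g : {linear F -> F''}).
Hypotheses (fg : short_exact f g) (pf : local_pure f) (flatF : flat F).

Let tensor_mapC (L M : lmodType A^c) (G G' : lmodType A) (a : {linear L -> M})
    (b : {linear G -> G'}) t :
  tensor_map (@idfun M) b (tensor_map a (@idfun G) t) =
  tensor_map a (@idfun G') (tensor_map (@idfun L) b t).
Proof. by rewrite !tensor_map_comp; apply: eq_tensor_map. Qed.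

(** L (x) F' embeds in M (x) F through L (x) F, and this embedding also factors through M (x) F'. *)
Lemma flat_pure_sub : flat F'.
Proof.
apply: flat_of_inj => L M a N b [ai _ _]; apply: raddf_inj => t /= at0.
apply: (local_pure_tensor pf); apply: (flat_inj flatF ai).
by rewrite -tensor_mapC at0 !raddf0.
Qed.

(** Diagram chase: [w] lifts to L (x) F, and in M (x) F this lift comes from M (x) F'. Injectivity
    of N (x) F' -> N (x) F brings that element from L (x) F', and flatness of [F] identifies its
    image with the lift. *)
Lemma flat_pure_quo : flat F''.
Proof.
have [fi fge gs] := fg.
apply: flat_of_inj => L M a N b [ai ab bs]; apply: raddf_inj => w /= aw0.
have [w0 w0E] : exists w0, tensor_map (@idfun L) g w0 = w.
  by apply: tensor_map_surj => // x; exists x.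
have /(tensor_exactr fge gs)[v vE] :
    tensor_map (@idfun M) g (tensor_map a (@idfun F) w0) = 0.
  by rewrite tensor_mapC w0E.
have /(tensor_exactl ab bs)[u uE] : tensor_map b (@idfun F') v = 0.
  apply: (local_pure_tensor pf); rewrite raddf0 tensor_mapC vE.
  by apply/(tensor_exactl ab bs); exists w0.
rewrite -w0E; apply/(tensor_exactr fge gs); exists u.
by apply: (flat_inj flatF ai); rewrite -tensor_mapC uE.
Qed.

End FlatPure.

(** * The classes F_C(S) and I_C(R) *)

Section Classes.
Variables (S R : pzRingType) (C : bimodType S R).

Lemma bihom_map_bij (N N' : lmodType S) (f : {linear N -> N'}) :
  bijective f -> bijective (bihom_map C f).
Proof.
move=> /bij_linear_inverse[g [fK gK]]; exists (bihom_map C g) => h;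
  apply: hom_ext => x; [exact: fK | exact: gK].
Qed.

Lemma bitensor_map_bij (F F' : lmodType R) (f : {linear F -> F'}) :
  bijective f -> bijective (bitensor_map C f).
Proof.
move=> /bij_linear_inverse[g [fK gK]]; exists (bitensor_map C g) => t;
  rewrite !bitensor_mapE tensor_map_comp -[RHS]tensor_map_id;
  exact: eq_tensor_map.
Qed.

Section FlatClass.
Variables (p q : nat) (e : 'I_p -> C) (rho : 'I_q -> 'I_p -> S).
Hypotheses (pres : presentation e rho) (b2 : bijective (rhomothety C)).

(** Purity enters in surjectivity. Arbitrary lifts of the values of [h] at the generators satisfy
    the relations up to elements [f (y l)]; purity solves the resulting system in [N'], and the
    solution is subtracted from the lifts. *)
Lemma bihom_short_exact (N' N N'' : lmodType S)
    (f : {linear N' -> N}) (g : {linear N -> N''}) :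
  short_exact f g -> local_pure f -> short_exact (bihom_map C f) (bihom_map C g).
Proof.
move=> [fi fg gs] pf; have [gen rel ex] := pres; split.
- apply: linear_inj => h fh0; apply: hom_ext => x; apply: fi.
  by rewrite -bihom_mapE fh0 linear0.
- move=> h; split=> [gh0|[h' <-]].
    have [|h' h'E] := lin_lift (h := h : {linear C -> N}) fi.
      by move=> x; apply/fg; rewrite -bihom_mapE gh0.
    by exists (h' : bihom C N'); apply: hom_ext.
  apply: hom_ext => x; have /fg : exists z, f z = f (h' x) by exists (h' x).
  by [].
move=> h; have /choice[n nE] : forall k, exists y, g y = h (e k).
  by move=> k; apply: gs.
have /choice[y yE] : forall l, exists z, f z = \sum_k rho l k *: n k.
  move=> l; apply/fg; rewrite linear_sum.
  transitivity ((h : {linear C -> N''}) (\sum_k rho l k *: e k)).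
    by rewrite linear_sum; apply: eq_bigr => k _; rewrite !linearZZ nE.
  by rewrite rel linear0.
have [|phi phiE] := pf [seq ([seq (rho l k, n k) | k <- enum 'I_p], y l) | l <- enum 'I_q].
  by move=> _ /mapP[l _ ->] /=; rewrite big_map big_enum /= yE.
have [l|h' h'E] := ex N (fun k => n k - f (phi (n k))).
  under eq_bigr do rewrite scalerBr -linearZ.
  rewrite sumrB -yE -linear_sum; apply/eqP; rewrite subr_eq0; apply/eqP.
  congr (f _); apply: esym.
  have /phiE /= : ([seq (rho l k, n k) | k <- enum 'I_p], y l) \in
      [seq ([seq (rho l k, n k) | k <- enum 'I_p], y l) | l <- enum 'I_q].
    by apply: (map_f (fun l => (_, y l))); rewrite mem_enum.
  by rewrite big_map big_enum.
exists (h' : bihom C N); apply: hom_ext; apply: (presentation_ext pres) => k.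
rewrite [LHS]bihom_mapE h'E linearB nE.
have /fg -> : exists z, f z = f (phi (n k)) by exists (phi (n k)).
by rewrite subr0.
Qed.

(** An isomorphism [u] from C (x) F to [N] gives an isomorphism [th] from [F] to Hom_S(C, N), and
    the counit composed with C (x) th is [u]; hence the counit is bijective. *)
Lemma C_flat_counit (N : lmodType S) :
  C_flat C N <-> flat (bihom C N) /\ bijective (counit_map C N).
Proof.
split=> [[F [flatF [u u_bij]]]|[flatN nu_bij]]; last first.
  by exists (bihom C N); split=> //; exists (counit_map C N).
pose th : {linear F -> bihom C N} := bihom_map C u \o unit_map C F.
have th_bij : bijective th.
  by apply: bij_comp; [exact: bihom_map_bij | exact: unit_bijective pres _ _].
split; first by apply: flat_iso flatF; exists th.
have nu_th t : counit_map C N (bitensor_map C th t) = u t.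
  elim/tensor_elim: t => [|t t' IHt IHt'|c x]; first by rewrite !raddf0.
    by rewrite !raddfD /= IHt IHt'.
  by rewrite bitensor_mapE tensor_map_pure counit_mapE.
have [v vK Kv] := bitensor_map_bij th_bij.
apply: (@eq_bij _ _ (u \o v)); last by move=> t /=; rewrite -nu_th Kv.
by apply: bij_comp => //; exists (bitensor_map C th).
Qed.

Hypothesis faithful : forall N : lmodType S,
  (forall h : lmodHom C N, h = 0) -> forall x : N, x = 0.

Lemma C_flat_pure (N' N N'' : lmodType S)
    (f : {linear N' -> N}) (g : {linear N -> N''}) :
  short_exact f g -> local_pure f -> C_flat C N -> C_flat C N' /\ C_flat C N''.
Proof.
move=> fg pf /C_flat_counit[flatN nu_bij].
have pHf := local_pure_bihom pres pf.
have Hfg := bihom_short_exact fg pf.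
have flatN' := flat_pure_sub pHf flatN.
have flatN'' := flat_pure_quo Hfg pHf flatN.
have [fi fge gs] := fg; have [_ Hfge Hgs] := Hfg.
have nu''_surj : surjective (counit_map C N'').
  move=> y; have [x <-] := gs y; have [nuV _ nuVK] := nu_bij.
  by exists (bitensor_map C (bihom_map C g) (nuV x)); rewrite counit_natural nuVK.
have nu''_inj : injective (counit_map C N'').
  have [K [io [io_inj ioE]]] := submodule_ex (kernel_submodule (counit_map C N'')).
  have K0 : forall k : K, k = 0.
    apply: faithful => h; apply: hom_ext => c; apply: io_inj.
    (* A map from [C] to the kernel is the image of some [x] under the unit; by the triangle
       identity [x] is the counit composed with that map, which is 0. *)
    have [v _ vK] := unit_bijective pres b2 flatN''.
    have [x xE] : exists x, unit_map C (bihom C N'') x = io \o h.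
      by exists (v (io \o h)); apply: vK.
    suff x0 : x = 0.
      rewrite -[LHS]/((io \o h : bihom C _) c) -xE x0 linear0.
      by rewrite [RHS]linear0.
    rewrite -[x]bihom_counit_unit xE; apply: hom_ext => d.
    by apply/ioE; exists (h d).
  by apply: linear_inj => t /ioE[k <-]; rewrite (K0 k) linear0.
have nu'_inj : injective (counit_map C N').
  apply: linear_inj => t t0; apply: (local_pure_tensor pHf (B := rightmod C)).
  rewrite raddf0 -[LHS]bitensor_mapE; apply: (bij_inj nu_bij).
  by rewrite counit_natural t0 !linear0.
have nu'_surj : surjective (counit_map C N').
  (* [t] dies in C (x) Hom_S(C, N'') because the counit of [N''] is injective, so it comes from C
     (x) Hom_S(C, N'). *)
  move=> y; have [nuV _ nuVK] := nu_bij; pose t := nuV (f y).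
  have : bitensor_map C (bihom_map C g) t = 0.
    apply: nu''_inj; rewrite counit_natural nuVK linear0.
    by apply/fge; exists y.
  move=> /(tensor_exactr Hfge Hgs)[t' t'E]; exists t'.
  by apply: fi; rewrite -counit_natural bitensor_mapE t'E nuVK.
by split; apply/C_flat_counit; split=> //; apply: inj_surj_bij.
Qed.

End FlatClass.

Section InjectiveClass.
Variables (p q : nat) (e : 'I_p -> rightmod C) (rho : 'I_q -> 'I_p -> R^c).
Hypotheses (pres : presentation e rho) (b1 : bijective (lhomothety C)).

(** Dually, Hom_S(C, th) composed with the unit of [M] is the isomorphism [v] from [M] to Hom_S(C,
    I). *)
Lemma C_injective_unit (M : lmodType R) :
  C_injective C M <-> injective_module (bitensor C M) /\ bijective (unit_map C M).
Proof.
split=> [[I [injI [u u_bij]]]|[injM mu_bij]]; last first.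
  exists (bitensor C M); split=> //; apply: lmod_iso_sym.
  by exists (unit_map C M).
have [v [uK vK]] := bij_linear_inverse u_bij.
pose th : {linear bitensor C M -> I} := counit_map C I \o bitensor_map C v.
have th_bij : bijective th.
  apply: bij_comp; first exact: counit_bijective pres _ _.
  by apply: bitensor_map_bij; exists u.
split.
  by apply: injective_iso injI; apply: lmod_iso_sym; exists th.
have [w wK Kw] := bihom_map_bij th_bij.
have mu_th x : bihom_map C th (unit_map C M x) = v x.
  apply: hom_ext => c; rewrite bihom_mapE unit_mapE.
  rewrite -[RHS]counit_mapE; congr (counit_map C I _).
  exact: tensor_map_pure.
apply: (@eq_bij _ _ (w \o v)); last by move=> x /=; rewrite -mu_th wK.
by apply: bij_comp; [exists (bihom_map C th) | exists u].
Qed.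

Hypothesis faithful : forall Q : lmodType R^c,
  (forall h : lmodHom (rightmod C) Q, h = 0) -> forall x : Q, x = 0.

Lemma C_injective_pure (M' M M'' : lmodType R)
    (f : {linear M' -> M}) (g : {linear M -> M''}) :
    left_noetherian S -> pure_exact f g -> local_pure f ->
  C_injective C M -> C_injective C M' /\ C_injective C M''.
Proof.
move=> noeth [[fi fge gs] fgT] pf /C_injective_unit[injM mu_bij].
have Tfg : short_exact (bitensor_map C f) (bitensor_map C g) := fgT (rightmod C).
have injM' := pure_injective noeth (local_pure_bitensor pf) injM.
have injM'' := injective_quotient Tfg injM' injM.
have [s sK] := injective_split Tfg injM'.
have [Tfi Tfge Tgs] := Tfg; have [muV muK muVK] := mu_bij.
have mu'_inj : injective (unit_map C M').
  move=> x y xy; apply: fi; apply: (bij_inj mu_bij).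
  by rewrite !unit_natural xy.
have nu'_inj : injective (counit_map C (bitensor C M')).
  exact: bij_inj (counit_bijective pres b1 injM').
have mu'_surj : surjective (unit_map C M').
  apply: (bitensor_faithful faithful) => t.
  exists (counit_map C (bitensor C M') t); apply: nu'_inj.
  by rewrite counit_bitensor_unit.
have mu''_surj : surjective (unit_map C M'').
  (* The splitting lifts [h] to a map from [C] to C (x) M, which is in the image of the unit of
     [M]. *)
  move=> h; exists (g (muV (s \o h))); rewrite unit_natural muVK.
  by apply: hom_ext => c; apply: sK.
have mu''_inj : injective (unit_map C M'').
  apply: linear_inj => y; have [x <-] := gs y; rewrite unit_natural => gx0.
  (* [unit_map C M x] takes its values in the image of C (x) M', so it comes from some [x'] under
     the unit of [M'], and x = f x'. *)
  have [|h hE] := lin_lift (h := unit_map C M x : {linear C -> bitensor C M}) Tfi.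
    by move=> c; apply/Tfge; rewrite -bihom_mapE gx0.
  have [x' x'E] := mu'_surj h; apply/fge; exists x'.
  apply: (bij_inj mu_bij); rewrite unit_natural x'E.
  by apply: hom_ext.
by split; apply/C_injective_unit; split=> //; apply: inj_surj_bij.
Qed.

End InjectiveClass.

End Classes.

Theorem lemma5p9 (R S : pzRingType) (C : bimodType S R)
    (hC : faithfully_semidualizing C) :
  (closed_pure_sub (C_flat C) /\ closed_pure_quo (C_flat C)) /\
  (left_noetherian S ->
   closed_pure_sub (C_injective C) /\
   closed_pure_quo (C_injective C)).
Proof.
have [[a1 a2 b1 b2 _ _] fl fr] := hC.
have [p [q [e [rho pres]]]] := resolution_presentation a1.
have [p' [q' [e' [rho' pres']]]] := resolution_presentation a2.
have pure_local (A : pzRingType) (N' N N'' : lmodType A) (f : {linear N' -> N})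
    (g : {linear N -> N''}) : pure_exact f g -> local_pure f.
  by move=> [_ fgT]; apply: tensor_local_pure => B; case: (fgT B).
split; first split.
- move=> N' N N'' f g fg CN; have [fgs _] := fg.
  by case: (C_flat_pure pres b2 fl fgs (pure_local _ _ _ _ _ _ fg) CN).
- move=> N' N N'' f g fg CN; have [fgs _] := fg.
  by case: (C_flat_pure pres b2 fl fgs (pure_local _ _ _ _ _ _ fg) CN).
move=> noeth; split=> M' M M'' f g fg CM.
  by case: (C_injective_pure pres' b1 fr noeth fg (pure_local _ _ _ _ _ _ fg) CM).
by case: (C_injective_pure pres' b1 fr noeth fg (pure_local _ _ _ _ _ _ fg) CM).
Qed.
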